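(* Let $k$ be an infinite field, let $n\ge 4$ and let $A=\{0=a_0<a_1<\dots<a_{n-1}=d\}\subset\mathbb{N}$ with $\gcd(a_1,\dots,a_{n-1})=1$. If $\mathcal{C}_A$ is not arithmetically Cohen-Macaulay, the following are equivalent: (1) The Castelnuovo-Mumford regularity of $k[\mathcal{C}_A]$ is attained at the last step of a minimal graded free resolution, i.e. $\beta_{p,\,p+\operatorname{reg}(k[\mathcal{C}_A])}\ne0$ where $p$ is the projective dimension of $k[\mathcal{C}_A]$. (2) $\operatorname{reg}(k[\mathcal{C}_A])=m(E_{\mathcal{S}})$, i.e. $m(E_{\mathcal{S}})\ge m(\operatorname{AP}_{\mathcal{S}})$. (3) $\operatorname{reg}(k[\mathcal{C}_A])=\operatorname{r}(k[\mathcal{C}_A])$.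
   Context: $\mathbb{N}=\{0,1,2,\dots\}$. $k[\mathcal{C}_A]=k[x_0,\dots,x_{n-1}]/I(\mathcal{C}_A)$, where $I(\mathcal{C}_A)$ is the kernel of the $k$-algebra homomorphism $k[x_0,\dots,x_{n-1}]\to k[u,v]$, $x_i\mapsto u^{a_i}v^{d-a_i}$; it is standard graded ($\deg x_i=1$) and is the homogeneous coordinate ring of the curve $\mathcal{C}_A\subset\mathbb{P}^{n-1}_k$. $\mathcal{C}_A$ is arithmetically Cohen-Macaulay if $k[\mathcal{C}_A]$ is a Cohen-Macaulay ring. $\beta_{i,j}$ are the graded Betti numbers of $k[\mathcal{C}_A]$ over $k[x_0,\dots,x_{n-1}]$, $\operatorname{reg}(k[\mathcal{C}_A])=\max\{j-i:\beta_{i,j}\ne0\}$, and $\operatorname{r}(k[\mathcal{C}_A])$ is the least integer $r$ such that the Hilbert function and Hilbert polynomial of $k[\mathcal{C}_A]$ agree at every integer $s\ge r$. Let $\mathbf{a}_i=(a_i,d-a_i)\in\mathbb{N}^2$ (so $\mathbf{a}_0=(0,d)$, $\mathbf{a}_{n-1}=(d,0)$), and let $\mathcal{S}\subset\mathbb{N}^2$ be the semigroup (with identity) generated by $\mathbf{a}_0,\dots,\mathbf{a}_{n-1}$. Define $\operatorname{AP}_{\mathcal{S}}=\{p\in\mathcal{S}: p-\mathbf{a}_0\notin\mathcal{S},\ p-\mathbf{a}_{n-1}\notin\mathcal{S}\}$ and $E_{\mathcal{S}}=\{p\in\mathcal{S}: p-\mathbf{a}_0\in\mathcal{S},\ p-\mathbf{a}_{n-1}\in\mathcal{S},\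 p-\mathbf{a}_0-\mathbf{a}_{n-1}\notin\mathcal{S}\}$ (both are finite sets). For $s\in\mathbb{N}$ let $L_s=\{(x,y)\in\mathbb{N}^2:x+y=sd\}$, $\operatorname{AP}_s=\operatorname{AP}_{\mathcal{S}}\cap L_s$, $E_s=E_{\mathcal{S}}\cap L_s$. Then $m(E_{\mathcal{S}})=\max\{s\in\mathbb{N}:E_{s+1}\neq\emptyset\}$ (with $m(E_{\mathcal{S}})=-\infty$ if $E_{\mathcal{S}}=\emptyset$) and $m(\operatorname{AP}_{\mathcal{S}})=\max\{s\in\mathbb{N}:\operatorname{AP}_s\neq\emptyset\}$. *)

(* Defs.v *)
From HB Require Import structures.
From mathcomp Require Import all_boot all_order all_algebra.
From mathcomp Require Import mpoly.

Set Implicit Arguments.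
Unset Strict Implicit.
Unset Printing Implicit Defensive.

Import Order.TTheory GRing.Theory Num.Theory.
Local Open Scope ring_scope.
Local Open Scope quotient_scope.

Definition infinite_type (T : eqType) : Prop :=
  forall s : seq T, exists x : T, x \notin s.

Definition is_max (P : int -> Prop) (m : int) : Prop :=
  P m /\ forall t, P t -> t <= m.

Definition is_min (P : int -> Prop) (m : int) : Prop :=
  P m /\ forall t, P t -> m <= t.

(* Maximum in Z extended by -oo, encoded by None; max of the empty set = -oo. *)
Definition is_emax (P : int -> Prop) (m : option int) : Prop :=
  if m is Some m' then is_max P m' else forall t, ~ P t.

Definition ele (x y : option int) : bool :=
  match x, y with
  | None, _ => true
  | Some _, None => false
  | Some x', Some y' => x' <= y'
  end.

(* Ideals are arbitrary Prop-valued subsets, so that the quantifications over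
   prime and maximal ideals are not restricted to decidable ideals.  The rings
   considered are commutative and Noetherian; the Cohen-Macaulay property is
   "depth P = height P for every maximal ideal P", with depth P the maximal
   length of a regular sequence contained in P (Eisenbud, Commutative Algebra,
   18.2). *)
Section CohenMacaulay.
Variable R : comNzRingType.
Implicit Types (I J P : R -> Prop) (s : seq R).

Definition is_ideal I : Prop :=
  [/\ I 0, forall x y, I x -> I y -> I (x + y)
         & forall r x, I x -> I (r * x)].

Definition is_prime_ideal P : Prop :=
  [/\ is_ideal P, ~ P 1 & forall x y, P (x * y) -> P x \/ P y].

Definition is_maximal_ideal P : Prop :=
  [/\ is_ideal P, ~ P 1
    & forall J, is_ideal J -> ~ J 1 -> (forall x, P x -> J x) ->
        forall x, J x -> P x].

Definition generated_ideal s : R -> Prop :=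
  fun x => exists c : 'I_(size s) -> R, x = \sum_i c i * s`_i.

Definition regular_sequence s : Prop :=
  (forall i, (i < size s)%N -> forall x,
     generated_ideal (take i s) (s`_i * x) -> generated_ideal (take i s) x)
  /\ ~ generated_ideal s 1.

Definition regular_sequence_in P s : Prop :=
  regular_sequence s /\ forall x, x \in s -> P x.

Definition is_depth P (h : nat) : Prop :=
  (exists2 s, regular_sequence_in P s & size s = h)
  /\ (forall s, regular_sequence_in P s -> (size s <= h)%N).

(* Strict chains c 0 < c 1 < ... < c h of prime ideals, with c h = P. *)
Definition prime_chain P (h : nat) (c : nat -> R -> Prop) : Prop :=
  [/\ forall i, (i <= h)%N -> is_prime_ideal (c i),
      forall i, (i < h)%N -> (forall x, c i x -> c i.+1 x)
                             /\ (exists x, c i.+1 x /\ ~ c i x)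
    & forall x, c h x <-> P x].

Definition is_height P (h : nat) : Prop :=
  (exists c, prime_chain P h c)
  /\ (forall l c, prime_chain P l c -> (l <= h)%N).

Definition cohen_macaulay : Prop :=
  forall P, is_maximal_ideal P -> exists h, is_height P h /\ is_depth P h.

End CohenMacaulay.

(* Graded modules over S = k[x_0, .., x_(n-1)]; [gr s] is the homogeneous
   component of degree s of M. *)
Section GradedModules.
Variables (k : fieldType) (n : nat) (M : lmodType {mpoly k[n]}).
Variable gr : int -> M -> Prop.

(* m is the dimension over k of the k-subspace V of M. *)
Definition has_kdim (V : M -> Prop) (m : nat) : Prop :=
  exists b : 'I_m -> M, (forall i, V (b i)) /\
    forall x, V x -> exists! c : 'rV[k]_m, x = \sum_i (c 0 i)%:MP *: b i.

Definition is_hilbert_function (H : int -> nat) : Prop :=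
  forall s, has_kdim (gr s) (H s).

Definition hilbert_agree (H : int -> nat) (P : {poly rat}) (s : int) : Prop :=
  (H s)%:R = P.[s%:~R].

Definition is_hilbert_polynomial (H : int -> nat) (P : {poly rat}) : Prop :=
  exists s0 : int, forall s, s0 <= s -> hilbert_agree H P s.

Definition is_hilbert_regularity (r : int) : Prop :=
  exists (H : int -> nat) (P : {poly rat}),
    [/\ is_hilbert_function H, is_hilbert_polynomial H P
      & is_min (fun r' => forall s, r' <= s -> hilbert_agree H P s) r].

(* The data ... -> F_1 -> F_0 -> M, with F_i the free S-module of row vectors
   of length [rk i], whose basis element number b has degree [shift b].  Row b
   of [bd i] is the image in F_i of basis element b of F_(i+1); [aug c] is the
   image in M of basis element c of F_0. *)
Record free_complex := FreeComplex {
  rk : nat -> nat;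
  shift : forall i, 'I_(rk i) -> int;
  bd : forall i, 'M[{mpoly k[n]}]_(rk i.+1, rk i);
  aug : 'I_(rk 0) -> M
}.

Variable F : free_complex.

Definition augment (v : 'rV[{mpoly k[n]}]_(rk F 0)) : M :=
  \sum_c v 0 c *: aug c.

Definition is_graded : Prop :=
  (forall c : 'I_(rk F 0), gr (shift c) (aug c))
  /\ (forall i (b : 'I_(rk F i.+1)) (c : 'I_(rk F i)) (m : 'X_{1..n}),
        m \in msupp (bd F i b c) -> shift c + (mdeg m)%:Z = shift b).

Definition is_resolution : Prop :=
  [/\ forall x : M, exists v, x = augment v,
      forall v, augment v = 0 <-> exists w, v = w *m bd F 0
    & forall i (v : 'rV_(rk F i.+1)),
        v *m bd F i = 0 <-> exists w, v = w *m bd F i.+1].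

(* The image of F_(i+1) lies in (x_0, .., x_(n-1)) F_i. *)
Definition is_minimal : Prop :=
  forall i (b : 'I_(rk F i.+1)) (c : 'I_(rk F i)), (bd F i b c)@_0%MM = 0.

Definition minimal_graded_free_resolution : Prop :=
  [/\ is_graded, is_resolution & is_minimal].

Definition betti (i : nat) (j : int) : nat :=
  #|[set b : 'I_(rk F i) | shift b == j]|.

Definition is_regularity (r : int) : Prop :=
  is_max (fun t => exists (i : nat) (j : int),
                     betti i j != 0%N /\ t = j - i%:Z) r.

(* p is the last step of the minimal resolution F. *)
Definition is_projdim (p : nat) : Prop :=
  rk F p != 0%N /\ forall i, (p < i)%N -> rk F i = 0%N.

End GradedModules.

Section MonomialCurve.
Variables (k : fieldType) (n : nat) (a : nat -> nat) (d : nat).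

(* u = 'X_0, v = 'X_1 *)
Definition param_map (p : {mpoly k[n]}) : {mpoly k[2]} :=
  p \mPo [tuple 'X_0 ^+ a i * 'X_1 ^+ (d - a i) | i < n].

Definition curve_ideal : {pred {mpoly k[n]}} :=
  fun p => param_map p == 0.

Lemma curve_idealP : idealr_closed curve_ideal.
Proof.
split; rewrite ?unfold_in /param_map ?comp_mpoly0 ?comp_mpoly1 ?oner_eq0 //.
move=> p q r; rewrite !unfold_in /param_map => /eqP q0 /eqP r0.
by rewrite comp_mpolyD rmorphM /= q0 r0 mulr0 addr0.
Qed.

HB.instance Definition _ :=
  isIdealr.Build {mpoly k[n]} curve_ideal curve_idealP.

Definition curve_ring : Type := {ideal_quot curve_ideal}.
HB.instance Definition _ := GRing.ComNzRing.on curve_ring.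

Definition curve_proj (p : {mpoly k[n]}) : curve_ring :=
  \pi_({ideal_quot curve_ideal}) p.

Definition curve_scale (p : {mpoly k[n]}) (x : curve_ring) : curve_ring :=
  curve_proj p * x.

Lemma curve_scaleA p q x :
  curve_scale p (curve_scale q x) = curve_scale (p * q) x.
Proof. by rewrite /curve_scale /curve_proj rmorphM mulrA. Qed.

Lemma curve_scale1 : left_id 1 curve_scale.
Proof. by move=> x; rewrite /curve_scale /curve_proj rmorph1 mul1r. Qed.

Lemma curve_scaleDr : right_distributive curve_scale +%R.
Proof. by move=> p x y; rewrite /curve_scale mulrDr. Qed.

Lemma curve_scaleDl x : {morph curve_scale^~ x : p q / p + q}.
Proof. by move=> p q; rewrite /curve_scale /curve_proj rmorphD mulrDl. Qed.

HB.instance Definition _ := GRing.Zmodule_isLmodule.Build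
  {mpoly k[n]} curve_ring curve_scaleA curve_scale1 curve_scaleDr curve_scaleDl.

(* For s < 0 only p = 0 qualifies, so the component is zero. *)
Definition curve_gr (s : int) (x : curve_ring) : Prop :=
  exists2 p : {mpoly k[n]},
    forall m, m \in msupp p -> (mdeg m)%:Z = s & x = curve_proj p.

End MonomialCurve.

(* Elements of N^2 are viewed in Z^2, so that the subtractions below are the
   genuine ones. *)
Section Semigroup.
Variables (n : nat) (a : nat -> nat) (d : nat).

Definition avec (i : nat) : int * int := ((a i)%:Z, (d - a i)%N%:Z).

Definition in_S (p : int * int) : Prop :=
  exists c : 'I_n -> nat, p = \sum_(i < n) avec i *+ c i.

Definition in_AP (p : int * int) : Prop :=
  [/\ in_S p, ~ in_S (p - avec 0) & ~ in_S (p - avec n.-1)].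

Definition in_E (p : int * int) : Prop :=
  [/\ in_S p, in_S (p - avec 0), in_S (p - avec n.-1)
    & ~ in_S (p - avec 0 - avec n.-1)].

Definition in_L (s : nat) (p : int * int) : Prop :=
  [/\ 0 <= p.1, 0 <= p.2 & p.1 + p.2 = (s * d)%N%:Z].

Definition is_mE (m : option int) : Prop :=
  is_emax (fun t => exists2 s : nat, t = s%:Z
                    & exists p, in_E p /\ in_L s.+1 p) m.

Definition is_mAP (m : option int) : Prop :=
  is_emax (fun t => exists2 s : nat, t = s%:Z
                    & exists p, in_AP p /\ in_L s p) m.

End Semigroup.

(* Main.v *)
Require Import Defs.
From HB Require Import structures.
From mathcomp Require Import all_boot all_order all_algebra.
From mathcomp Require Import mpoly.
From mathcomp Require Import zify ring.
From mathcomp Require Import boolp.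
From mathcomp Require classical_sets.

Set Implicit Arguments.
Unset Strict Implicit.
Unset Printing Implicit Defensive.

Import Order.TTheory GRing.Theory Num.Theory.
Local Open Scope ring_scope.
Local Open Scope quotient_scope.

(* Reducing the resolution modulo x_0, then x_(n-1), then the other variables
   one at a time, the long exact sequences reduce everything to the first two
   steps: Tor_0(R, S/(x_0, x_(n-1))) is supported on AP_S, and
   Tor_1(R, S/(x_0, x_(n-1))) on E_S.  Degrees i + s with s larger than both
   m(AP_S) and m(E_S) never occur in Tor_i; along Tor_(m-1) for m variables only
   E_S matters, and the top degree of each line survives to the last variable.
   If E_S is nonempty, this gives projective dimension n-1,
   reg = max(m(AP_S), m(E_S)), and that m(E_S) is the top degree at the last step.

   Inclusion-exclusion on the line x + y = sd shows that the second difference of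
   the Hilbert function at s is |AP_s| - |E_s|, from which the Hilbert regularity
   is read off.

   If E_S is empty, R is Cohen-Macaulay.  Any three elements of R are
   algebraically dependent, so neither a chain of primes nor a regular sequence
   has length 3.  By Zariski's lemma a maximal ideal P contains nonzero f(x_0) and
   g(x_(n-1)); emptiness of E_S makes them a regular sequence, and Zorn's lemma
   then yields a prime strictly between 0 and P. *)

(** * Supports of polynomials *)

(** No Tor module is formed: a class of Tor_i is a row of F_i modulo rows with entries in a monomial
    ideal, so the exact sequences become chases of rows, and divisibility is decided monomial by
    monomial. The end variables come first because R is a monomial domain: x_0 is regular, and E_S
    is exactly what keeps x_(n-1) from being regular on R/x_0 R (for p in E_S, the monomial at p -
    a_(n-1) becomes divisible by x_0 only after multiplication by x_(n-1)). A class of top degree is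
    killed by the next variable, so it propagates through the connecting map; one from AP_S starts
    in Tor_0 and ends at step n-2, one from E_S starts in Tor_1 and ends at step n-1. For AP_S this
    requires m(E_S) <= m(AP_S), as otherwise E_S may occupy the next degree; in that case E_S
    already gives the regularity. On the Cohen-Macaulay side every maximal ideal counts, not only
    the irrelevant one, hence the replacement of x_0 and x_(n-1) by polynomials in them. *)

Section Supports.
Variables (n : nat) (k : fieldType).
Implicit Types (p q : {mpoly k[n]}) (Q : 'X_{1..n} -> bool).

Definition supp_in (D : 'X_{1..n} -> Prop) p := forall m, m \in msupp p -> D m.

Lemma supp_in0 D : supp_in D 0.
Proof. by move=> m; rewrite msupp0. Qed.

Lemma supp_inX (D : _ -> Prop) m : D m -> supp_in D 'X_[m].
Proof. by move=> Dm m'; rewrite msuppX inE => /eqP ->. Qed.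

Lemma supp_inD D p q : supp_in D p -> supp_in D q -> supp_in D (p + q).
Proof.
move=> Dp Dq m /msuppD_le; rewrite mem_cat => /orP[]; [exact: Dp|exact: Dq].
Qed.

Lemma supp_inN D p : supp_in D p -> supp_in D (- p).
Proof. by move=> Dp m; rewrite (perm_mem (msuppN p)); apply: Dp. Qed.

Lemma supp_inB D p q : supp_in D p -> supp_in D q -> supp_in D (p - q).
Proof. by move=> Dp Dq; apply: supp_inD => //; apply: supp_inN. Qed.

Lemma supp_inZ D (c : k) p : supp_in D p -> supp_in D (c *: p).
Proof. by move=> Dp m /msuppZ_le; apply: Dp. Qed.

Lemma supp_in_sum D (I : Type) (r : seq I) (P : pred I) (f : I -> {mpoly k[n]}) :
  (forall i, P i -> supp_in D (f i)) -> supp_in D (\sum_(i <- r | P i) f i).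
Proof.
move=> Df; elim/big_ind: _ => //; [exact: supp_in0|exact: supp_inD].
Qed.

Lemma supp_inM (D1 D2 D : _ -> Prop) p q :
  (forall m1 m2, D1 m1 -> D2 m2 -> D (m1 + m2)%MM) ->
  supp_in D1 p -> supp_in D2 q -> supp_in D (p * q).
Proof.
move=> D12 Dp Dq m /msuppM_le /allpairsP[[m1 m2] /= [h1 h2 ->]].
by apply: D12; [apply: Dp|apply: Dq].
Qed.

Lemma supp_in_eq0 (D1 D2 : _ -> Prop) p :
  (forall m, D1 m -> D2 m -> False) -> supp_in D1 p -> supp_in D2 p -> p = 0.
Proof.
move=> D12 D1p D2p; apply/mpolyP => m; rewrite mcoeff0; apply/eqP.
rewrite mcoeff_eq0; apply/negP => mp; exact: D12 (D1p _ mp) (D2p _ mp).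
Qed.

Definition mrestrict Q p := \sum_(m <- msupp p | Q m) p@_m *: 'X_[m].

Lemma mcoeff_mrestrict Q p m : (mrestrict Q p)@_m = if Q m then p@_m else 0.
Proof.
rewrite /mrestrict raddf_sum /=.
under eq_bigr do rewrite mcoeffZ mcoeffX.
have [mp|mp] := boolP (m \in msupp p); last first.
  rewrite big_seq_cond big1.
    by rewrite (memN_msupp_eq0 mp) if_same.
  move=> i /andP[ip _]; case: eqP => [eim|]; last by rewrite mulr0.
  by rewrite -eim ip in mp.
rewrite big_mkcond (bigD1_seq m) //= eqxx mulr1 big1 ?addr0 // => i nim.
by rewrite (negPf nim) mulr0 if_same.
Qed.

Lemma supp_in_mrestrict Q D p :
  (forall m, m \in msupp p -> Q m -> D m) -> supp_in D (mrestrict Q p).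
Proof.
move=> QD m; rewrite mcoeff_msupp mcoeff_mrestrict.
by case: ifP; rewrite ?eqxx // => Qm; rewrite -mcoeff_msupp => /QD; apply.
Qed.

Lemma supp_in_mrestrictC Q D p :
  (forall m, m \in msupp p -> ~~ Q m -> D m) -> supp_in D (p - mrestrict Q p).
Proof.
move=> QD m; rewrite mcoeff_msupp mcoeffB mcoeff_mrestrict.
case: ifPn => Qm; first by rewrite subrr eqxx.
by rewrite subr0 -mcoeff_msupp => /QD; apply.
Qed.

Lemma supp_in_divX (m0 : 'X_{1..n}) D p :
    (forall m, m \in msupp p -> exists2 m', m = (m0 + m')%MM & D m') ->
  exists2 q, p = 'X_[m0] * q & supp_in D q.
Proof.
move=> h; exists (\sum_(m <- msupp p) p@_m *: 'X_[m - m0]).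
  rewrite {1}(mpolyE p) mulr_sumr !big_seq; apply: eq_bigr => m mp.
  rewrite -scalerAr -mpolyXD; have [m' em _] := h _ mp.
  have -> : (m - m0)%MM = m' by rewrite em addmC addmK.
  by rewrite -em.
rewrite big_seq; apply: supp_in_sum => m mp; apply: supp_inZ; apply: supp_inX.
by have [m' -> Dm'] := h _ mp; rewrite addmC addmK.
Qed.

Lemma mpolyX_mulI (m : 'X_{1..n}) p q : 'X_[m] * p = 'X_[m] * q -> p = q.
Proof.
move=> h; apply/mpolyP => m'; move/(congr1 (mcoeff (m + m'))): h.
by rewrite !(mulrC (mpolyX _ _)) !mcoeffMX.
Qed.

End Supports.

(** * Tor from a graded free resolution, one variable at a time *)

Section Chase.
Variables (k : fieldType) (n : nat) (M : lmodType {mpoly k[n]}).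
Variable (gr : int -> M -> Prop) (F : free_complex M).
Hypothesis F_graded : is_graded gr F.
Hypothesis F_res : is_resolution F.
Implicit Types (i : nat) (j : int) (y : 'I_n) (Y : {set 'I_n}) (D : int -> Prop).

Let row i := 'rV[{mpoly k[n]}]_(rk F i).

Definition degs i D (v : row i) : Prop :=
  forall c, supp_in (fun m => D (shift c + (mdeg m)%:Z)) (v 0 c).

(** Rows with entries in the ideal (x_y, y in [Y]): as the ideal is monomial, membership is tested
    on each monomial separately. *)
Definition inJ i Y (v : row i) : Prop :=
  forall c, supp_in (fun m => exists2 y, y \in Y & m y != 0%N) (v 0 c).

Definition of_deg i j : row i -> Prop := degs (fun t => t = j).

Lemma of_degB i j (v w : row i) : of_deg j v -> of_deg j w -> of_deg j (v - w).
Proof. by move=> hv hw c; rewrite !mxE; apply: supp_inB. Qed.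

Lemma inJ0 i Y : inJ Y (0 : row i).
Proof. by move=> c; rewrite mxE; apply: supp_in0. Qed.

Lemma inJD i Y (v w : row i) : inJ Y v -> inJ Y w -> inJ Y (v + w).
Proof. by move=> hv hw c; rewrite mxE; apply: supp_inD. Qed.

Lemma inJN i Y (v : row i) : inJ Y v -> inJ Y (- v).
Proof. by move=> hv c; rewrite mxE; apply: supp_inN. Qed.

Lemma inJB i Y (v w : row i) : inJ Y v -> inJ Y w -> inJ Y (v - w).
Proof. by move=> hv hw; apply: inJD => //; apply: inJN. Qed.

Lemma inJS i Y Y' (v : row i) : Y \subset Y' -> inJ Y v -> inJ Y' v.
Proof.
move=> /subsetP sYY' hv c m /hv[y yY my]; by exists y => //; apply: sYY'.
Qed.

Lemma inJM i i' Y (v : row i) (A : 'M_(rk F i, rk F i')) :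
  inJ Y v -> inJ Y (v *m A).
Proof.
move=> hv c; rewrite mxE; apply: supp_in_sum => b _.
apply: (supp_inM (D2 := fun=> True)) (hv b) _ => // m1 m2 [y yY m1y] _.
by exists y => //; rewrite mnmDE addn_eq0 negb_and m1y.
Qed.

Lemma inJZ i Y p (v : row i) : inJ Y v -> inJ Y (p *: v).
Proof.
move=> hv c; rewrite mxE; apply: (supp_inM (D1 := fun=> True)) (hv c) => //.
by move=> m1 m2 _ [z zY mz]; exists z => //; rewrite mnmDE addn_eq0 negb_and mz orbT.
Qed.

Lemma inJX_mem i Y y (v : row i) : y \in Y -> inJ Y ('X_y *: v).
Proof.
move=> yY c; rewrite mxE.
apply: (supp_inM (D1 := fun m => m = U_(y)%MM) (D2 := fun=> True)) => //.
- by move=> _ m2 -> _; exists y => //; rewrite mnmDE mnm1E eqxx.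
- exact: supp_inX.
Qed.

Lemma inJX i Y y (v : row i) : y \notin Y -> inJ Y ('X_y *: v) -> inJ Y v.
Proof.
move=> yY hv c m mv.
have: (U_(y) + m)%MM \in msupp (('X_y *: v) 0 c).
  by rewrite mxE mcoeff_msupp mulrC mcoeffMX -mcoeff_msupp.
move=> /hv[z zY]; rewrite mnmDE mnm1E.
have [yz|_] := eqVneq y z; first by rewrite yz zY in yY.
by rewrite add0n => mz; exists z.
Qed.

Lemma of_degX i j y (v : row i) : of_deg j v -> of_deg (j + 1) ('X_y *: v).
Proof.
move=> hv c; rewrite mxE.
apply: (supp_inM (D1 := fun m => m = U_(y)%MM)) (hv c); last exact: supp_inX.
by move=> _ m2 -> <-; rewrite mdegD mdeg1 PoszD addrCA addrC.
Qed.

(** Once the monomials involving [Y] are removed, each remaining one involves x_y and can be divided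
    by it. *)
Lemma inJ_split i Y y j (v : row i) : inJ (y |: Y) v -> of_deg j v ->
  exists2 w : row i, of_deg (j - 1) w & inJ Y (v - 'X_y *: w).
Proof.
move=> Jv hv.
pose Q (m : 'X_{1..n}) := [exists z, (z \in Y) && (m z != 0%N)].
have QP (m : 'X_{1..n}) : reflect (exists2 z, z \in Y & m z != 0%N) (Q m).
  apply: (iffP existsP) => [[z /andP[]]|[z zY mz]]; first by exists z.
  by exists z; rewrite zY.
have /fin_all_exists2[w hw wE] : forall c, exists2 w : {mpoly k[n]},
    supp_in (fun m => shift c + (mdeg m)%:Z = j - 1) w
    & v 0 c - mrestrict Q (v 0 c) = 'X_y * w.
  move=> c.
  have hD : forall m, m \in msupp (v 0 c - mrestrict Q (v 0 c)) ->
      exists2 m', m = (U_(y) + m')%MM & shift c + (mdeg m')%:Z = j - 1.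
    apply: supp_in_mrestrictC => m mv /QP nQ.
    have [z] := Jv c m mv; rewrite !inE => /orP[/eqP->|zY mz]; last first.
      by case: nQ; exists z.
    rewrite -lt0n => my; have le1 : (U_(y) <= m)%MM.
      by apply/mnm_lepP => t; rewrite mnm1E; case: eqP => [<-|].
    exists (m - U_(y))%MM; first by rewrite addmC submK.
    have := hv c m mv; rewrite -{1}(submK le1) mdegD mdeg1 PoszD addrA => <-.
    by rewrite addrK.
  by have [q -> hq] := supp_in_divX hD; exists q.
exists (\row_c w c) => c; rewrite !mxE; first exact: hw.
rewrite -wE opprB addrC subrK.
by apply: supp_in_mrestrict => m _ /QP.
Qed.

Lemma degs_bd i D (v : row i.+1) : degs D v -> degs D (v *m bd F i).
Proof.
move=> hv c; rewrite mxE; apply: supp_in_sum => b _.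
apply: (supp_inM (D2 := fun m => shift c + (mdeg m)%:Z = shift b)) (hv b) _.
  move=> m1 m2 h e; have -> // : shift c + (mdeg (m1 + m2))%:Z = shift b + (mdeg m1)%:Z.
  by rewrite mdegD -e PoszD; ring.
by move=> m /(proj2 F_graded).
Qed.

Lemma degs_split i D (v : row i) : exists v1 v2 : row i,
  [/\ v = v1 + v2, degs D v1 & degs (fun t => ~ D t) v2].
Proof.
pose Q c (m : 'X_{1..n}) :=
  `[< D (@shift _ _ _ F i c + (mdeg m)%:Z) >].
exists (\row_c mrestrict (Q c) (v 0 c)),
  (\row_c (v 0 c - mrestrict (Q c) (v 0 c))); split.
- by apply/rowP => c; rewrite !mxE addrC subrK.
- by move=> c; rewrite mxE; apply: supp_in_mrestrict => m _ /asboolP.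
- by move=> c; rewrite mxE; apply: supp_in_mrestrictC => m _ /asboolPn.
Qed.

Lemma degs_eq0 i D (v : row i) : degs D v -> degs (fun t => ~ D t) v -> v = 0.
Proof.
move=> h1 h2; apply/rowP => c; rewrite mxE.
exact: (supp_in_eq0 (fun m h h' => h' h)) (h1 c) (h2 c).
Qed.

(** The part of [w] outside degree [j] maps outside degree [j], yet its image is a difference of two
    rows of degree [j]; so it maps to 0. *)
Lemma of_deg_preim i j (w : row i.+1) : of_deg j (w *m bd F i) ->
  exists2 w', of_deg j w' & w' *m bd F i = w *m bd F i.
Proof.
have [w1 [w2 [-> h1 h2]]] := degs_split (fun t => t = j) w.
rewrite mulmxDl => h; exists w1 => //.
have -> : w2 *m bd F i = 0; last by rewrite addr0.
apply: degs_eq0 (degs_bd h2).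
have -> : w2 *m bd F i = w1 *m bd F i + w2 *m bd F i - w1 *m bd F i.
  by rewrite addrAC subrr add0r.
exact: of_degB h (degs_bd h1).
Qed.

Lemma bd_bd i (w : row i.+2) : w *m bd F i.+1 *m bd F i = 0.
Proof. by case: F_res => _ _ /(_ i (w *m bd F i.+1))[_]; apply; exists w. Qed.

Definition cyc Y i : row i -> Prop :=
  if i is i'.+1 then fun v : row i'.+1 => inJ Y (v *m bd F i') else fun=> True.

Definition bdry Y i j (v : row i) : Prop :=
  exists2 w : row i.+1, of_deg j w & inJ Y (v - w *m bd F i).

(* Vanishing in degree j of Tor_i(M, S / (x_y, y in Y)), S = k[x_0, .., x_(n-1)]. *)
Definition tor0 Y i j : Prop := forall v : row i, of_deg j v -> cyc Y v -> bdry Y j v.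

Lemma cyc_bd Y i (w : row i.+1) : cyc Y (w *m bd F i).
Proof. by case: i w => //= i w; rewrite bd_bd; apply: inJ0. Qed.

Lemma cycX Y y i (v : row i) : y \notin Y -> cyc Y ('X_y *: v) -> cyc Y v.
Proof. by case: i v => //= i v yY; rewrite -scalemxAl; apply: inJX. Qed.

Lemma cycXr Y y i (v : row i) : cyc Y v -> cyc Y ('X_y *: v).
Proof.
by case: i v => //= i v h; rewrite -scalemxAl; apply: inJZ.
Qed.

Lemma cycB Y i (v w : row i) : cyc Y v -> cyc Y w -> cyc Y (v - w).
Proof. by case: i v w => //= i v w ? ?; rewrite mulmxBl; apply: inJB. Qed.

Lemma cycJ Y i (v : row i) : inJ Y v -> cyc Y v.
Proof. by case: i v => //= i v ?; apply: inJM. Qed.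

(** Exactness at Tor_(i+1) of the larger set: a cycle [v] has bd v = x_y w modulo [Y]; by the
    injectivity hypothesis w = bd w' modulo [Y], and then v - x_y w' is a cycle modulo [Y]
    itself. *)
Lemma tor0_step Y y i j : y \notin Y ->
    (forall w : row i, of_deg (j - 1) w -> cyc Y w ->
       bdry Y j ('X_y *: w) -> bdry Y (j - 1) w) ->
  tor0 Y i.+1 j -> tor0 (y |: Y) i.+1 j.
Proof.
move=> yY regy Ty v hv /= cv.
have [w hw Jw] := inJ_split cv (degs_bd hv).
have cw : cyc Y w.
  apply: (cycX yY); rewrite -[_ *: w](subKr (v *m bd F i)).
  by apply: cycB; [exact: cyc_bd | apply: cycJ].
have [|w' hw' Jw'] := regy w hw cw.
  by exists v => //; rewrite -opprB; apply: inJN.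
have hyw' : of_deg j ('X_y *: w') by rewrite -[j](subrK 1); apply: of_degX.
have [|u hu Ju] := Ty (v - 'X_y *: w') (of_degB hv hyw').
  rewrite /= mulmxBl -scalemxAl.
  have -> : v *m bd F i - 'X_y *: (w' *m bd F i)
      = v *m bd F i - 'X_y *: w + 'X_y *: (w - w' *m bd F i).
    by rewrite scalerBr addrA subrK.
  apply: inJD => //.
  exact: inJZ.
exists u => //; rewrite -[v](subrK ('X_y *: w')) addrAC.
by apply: inJD; [apply: inJS (subsetU1 _ _) Ju | apply: inJX_mem; rewrite setU11].
Qed.

Lemma tor0_step2 Y y i j : y \notin Y ->
  tor0 Y i.+1 j -> tor0 Y i (j - 1) -> tor0 (y |: Y) i.+1 j.
Proof. by move=> yY T1 T2; apply: tor0_step => // w hw cw _; apply: T2. Qed.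

Lemma tor0_step0 Y y j : tor0 Y 0 j -> tor0 (y |: Y) 0 j.
Proof.
move=> T v hv _; have [//|w hw Jw] := T v hv.
by exists w => //; apply: inJS (subsetU1 _ _) Jw.
Qed.

(** The class of [v] is killed by x_y, as Tor_i vanishes one degree higher, so it comes from
    Tor_(i+1) through the connecting map; a preimage is any [w] with x_y v = bd w modulo [Y]. *)
Lemma tor_neq0_step Y y i j (v : row i) : y \notin Y ->
    of_deg j v -> cyc Y v -> ~ bdry Y j v -> tor0 Y i (j + 1) ->
  exists w : row i.+1,
    [/\ of_deg (j + 1) w, cyc (y |: Y) w & ~ bdry (y |: Y) (j + 1) w].
Proof.
move=> yY hv cv nv T.
have [w hw Jw] := T ('X_y *: v) (of_degX hv) (cycXr y cv).
exists w; split=> //.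
  rewrite /= -[_ *m _](subKr ('X_y *: v)); apply: inJB.
    by apply: inJX_mem; rewrite setU11.
  exact: inJS (subsetU1 _ _) Jw.
(* If [w] were trivial, w - bd w' would be x_y w2 modulo [Y]; applying bd and cancelling x_y makes
   [v] the boundary of [w2]. *)
move=> [w' hw' Jw'].
have [w2 hw2 Jw2] := inJ_split Jw' (of_degB hw (degs_bd hw')).
apply: nv; exists w2; first by rewrite -[j](addrK 1).
apply: (inJX yY); rewrite scalerBr scalemxAl.
have -> : 'X_y *: v - 'X_y *: w2 *m bd F i = 'X_y *: v - w *m bd F i
    + (w - w' *m bd F i.+1 - 'X_y *: w2) *m bd F i.
  by rewrite !mulmxBl bd_bd subr0 addrA subrK.
by apply: inJD => //; apply: inJM.
Qed.

Lemma mnm_neq0 (m : 'X_{1..n}) : m != 0%MM -> exists z, m z != 0%N.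
Proof.
move=> h; apply/existsP; apply: contraNT h => /existsPn h.
by apply/eqP/mnmP => z; rewrite mnm0E; have := h z; rewrite negbK => /eqP.
Qed.

(** Without a generator in degree [j], no entry of [v] has a constant term, so [v] is 0 modulo the
    variables. *)
Lemma betti_neq0 i j (v : row i) : of_deg j v -> ~ bdry setT j v ->
  betti F i j != 0%N.
Proof.
move=> hv nv; apply/negP; rewrite cards_eq0 => /eqP b0; apply: nv.
exists 0; first by move=> c; rewrite mxE; apply: supp_in0.
rewrite mul0mx subr0 => c m mv.
have /mnm_neq0[z mz] : m != 0%MM; last by exists z.
apply/eqP => m0; have := hv c m mv; rewrite m0 mdeg0 addr0 => sc.
by have := in_set0 c; rewrite -b0 inE sc eqxx.
Qed.

Hypothesis F_min : is_minimal F.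

Lemma cycT i (v : row i) : cyc setT v.
Proof.
case: i v => //= i v c; rewrite mxE; apply: supp_in_sum => b _.
apply: (supp_inM (D1 := fun=> True) (D2 := fun m => m <> 0%MM)) => //.
  move=> m1 m2 _ /eqP m2N0; have /mnm_neq0[z hz] : (m1 + m2)%MM != 0%MM.
    by rewrite mnmD_eq0 negb_and m2N0 orbT.
  by exists z.
by move=> m; rewrite mcoeff_msupp => /eqP h e; apply: h; rewrite e; apply: F_min.
Qed.

(** By minimality boundaries vanish modulo all variables, so a basis row of degree [j] is a cycle
    but not a boundary. *)
Lemma tor0_betti i j : tor0 setT i j -> betti F i j = 0%N.
Proof.
move=> T; apply/eqP; rewrite cards_eq0; apply/eqP/setP => b.
rewrite !inE; apply/negP => /eqP sb.
have hb : of_deg j (delta_mx 0 b : row i).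
  move=> c; rewrite mxE eqxx /= => m; case: eqP => [->|_].
    by rewrite msupp1 inE => /eqP ->; rewrite mdeg0 addr0.
  by rewrite msupp0.
have [w _ Jw] := T _ hb (cycT _).
have /(inJD Jw) := @cycT i.+1 w; rewrite subrK => /(_ b 0%MM).
rewrite mxE !eqxx msupp1 inE eqxx => /(_ isT) [z _].
by rewrite mnm0E.
Qed.

End Chase.

(** * The semigroup and the coordinate ring *)

Definition curve_exponents (n : nat) (a : nat -> nat) (d : nat) : Prop :=
  [/\ (1 < n)%N, a 0%N = 0%N, a n.-1 = d
    & forall i j, (i < j < n)%N -> (a i < a j)%N].

Lemma in_L0 d : in_L d 0 0. Proof. by split. Qed.

Lemma in_LD d s t p q : in_L d s p -> in_L d t q -> in_L d (s + t) (p + q).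
Proof. by case: p q => [p1 p2] [q1 q2] [/= ? ? ?] [/= ? ? ?]; split => /=; lia. Qed.

Section Semigroup.
Variables (n : nat) (a : nat -> nat) (d : nat).
Hypothesis A : curve_exponents n a d.

Let n_gt1 : (1 < n)%N. Proof. by case: A. Qed.
Let a_first : a 0%N = 0%N. Proof. by case: A. Qed.
Let a_last : a n.-1 = d. Proof. by case: A. Qed.
Let a_incr i j : (i < j < n)%N -> (a i < a j)%N.
Proof. by case: A => _ _ _; apply. Qed.

Local Notation S := (in_S n a d).

Lemma a_le_d i : (i < n)%N -> (a i <= d)%N.
Proof.
move=> lt_in; rewrite -a_last; have [->|ne] := eqVneq i n.-1; first by [].
by apply/ltnW/a_incr; lia.
Qed.

Lemma d_gt0 : (0 < d)%N.
Proof. by rewrite -a_last; apply: leq_ltn_trans (leq0n (a 0)) (a_incr _); lia. Qed.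

Lemma avec0 : avec a d 0 = (0, d%:Z).
Proof. by rewrite /avec a_first subn0. Qed.

Lemma avecN : avec a d n.-1 = (d%:Z, 0).
Proof. by rewrite /avec a_last subnn. Qed.

Lemma in_S0 : S 0.
Proof. by exists (fun=> 0%N); rewrite big1 // => i _; rewrite mulr0n. Qed.

Lemma in_SD p q : S p -> S q -> S (p + q).
Proof.
move=> [c ->] [c' ->]; exists (fun i => c i + c' i)%N.
by rewrite -big_split; apply: eq_bigr => i _; rewrite mulrnDr.
Qed.

Lemma in_S_avec i : (i < n)%N -> S (avec a d i).
Proof.
move=> lt_in; exists (fun j => j == Ordinal lt_in).
rewrite (bigD1 (Ordinal lt_in)) //= eqxx mulr1n big1 ?addr0 // => j /negPf ->.
by rewrite mulr0n.
Qed.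


Lemma in_L_avec i : (i < n)%N -> in_L d 1 (avec a d i).
Proof. by move=> /a_le_d le; split => /=; lia. Qed.

Lemma in_L_sum (c : 'I_n -> nat) :
  in_L d (\sum_(i < n) c i) (\sum_(i < n) avec a d i *+ c i).
Proof.
apply: (big_ind2 (in_L d)) => [|s p t q|i _]; [exact: in_L0|exact: in_LD|].
elim: (c i) => [|m IH]; first exact: in_L0.
by rewrite mulrS -add1n; apply: in_LD => //; apply: in_L_avec.
Qed.

Lemma in_S_deg p : S p -> exists s, in_L d s p.
Proof. by move=> [c ->]; exists (\sum_(i < n) c i)%N; apply: in_L_sum. Qed.

Lemma in_L_inj s t p : in_L d s p -> in_L d t p -> s = t.
Proof.
move=> [_ _ e1] [_ _]; rewrite e1 => /eqP; rewrite eqz_nat eqn_pmul2r ?d_gt0 //.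
by move=> /eqP.
Qed.

Lemma in_LB s t p q : in_L d s p -> in_L d t q -> S (p - q) -> 
  (t <= s)%N /\ in_L d (s - t) (p - q).
Proof.
move=> Lp Lq /in_S_deg[m Lpq]; have := in_LD Lpq Lq; rewrite subrK.
by move=> /(in_L_inj Lp) ->; rewrite leq_addl addnK.
Qed.

End Semigroup.

(** * The coordinate ring as a monomial subring of k[u,v] *)

Section Embedding.
Variables (k : fieldType) (n : nat) (a : nat -> nat) (d : nat).
Local Notation R := (curve_ring k n a d).
Local Notation S := (in_S n a d).

Definition pt (m : 'X_{1..2}) : int * int := ((m ord0)%:Z, (m ord_max)%:Z).

Lemma ptD m1 m2 : pt (m1 + m2)%MM = pt m1 + pt m2.
Proof. by rewrite /pt !mnmDE !PoszD. Qed.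

Lemma ptMn m c : pt (m *+ c)%MM = pt m *+ c.
Proof. by elim: c => [|c IH]; rewrite ?mulmS ?ptD ?IH ?mulrS // /pt !mnm0E. Qed.

Lemma pt_inj : injective pt.
Proof.
move=> m1 m2 [e0 e1]; apply/mnmP => -[[|[|i]] hi] //.
  by have -> : Ordinal hi = ord0 by apply: val_inj.
by have -> : Ordinal hi = ord_max by apply: val_inj.
Qed.

Lemma mdeg_pt m : (mdeg m)%:Z = (pt m).1 + (pt m).2.
Proof. by rewrite mdegE big_ord_recl big_ord1 PoszD; congr (_ + (m _)%:Z); apply: val_inj. Qed.

Lemma in_L_pt s m : in_L d s (pt m) <-> mdeg m = (s * d)%N.
Proof.
split=> [[_ _]|e]; first by rewrite -mdeg_pt => -[].
by split=> //; rewrite -mdeg_pt e.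
Qed.

Lemma pt_surj p : 0 <= p.1 -> 0 <= p.2 -> exists m, pt m = p.
Proof.
case: p => [[x|//] [y|//]] _ _.
exists [multinom if i == ord0 then x else y | i < 2].
by rewrite /pt !mnmE.
Qed.

Definition wexp (c : 'X_{1..n}) : 'X_{1..2} :=
  (\sum_(i < n) (U_(ord0) *+ a i + U_(ord_max) *+ (d - a i)) *+ c i)%MM.

Lemma pt_wexp c : pt (wexp c) = \sum_(i < n) avec a d i *+ c i.
Proof.
rewrite /wexp (big_morph pt ptD (_ : pt 0%MM = 0)); last by rewrite /pt !mnm0E.
apply: eq_bigr => i _; rewrite ptMn; congr (_ *+ _).
by rewrite /pt /avec !mnmDE !mulmnE !mnm1E /= !mul1n !mul0n addn0.
Qed.

Lemma param_mapX c : param_map a d ('X_[c] : {mpoly k[n]}) = 'X_[wexp c].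
Proof.
rewrite /param_map comp_mpolyX /wexp -mprodXE; apply: eq_bigr => i _.
rewrite tnth_mktuple -mpolyXn mpolyXD -!mpolyXn.
congr ((_ * 'X_ _ ^+ _) ^+ _); exact: val_inj.
Qed.

End Embedding.

Section Embed.
Variables (k : fieldType) (n : nat) (a : nat -> nat) (d : nat).
Local Notation R := (curve_ring k n a d).
Local Notation S := (in_S n a d).
Local Notation proj := (@curve_proj k n a d).

Lemma curve_projP (x : R) : exists p, x = proj p.
Proof. by exists (repr x); rewrite /curve_proj reprK. Qed.

Lemma curve_proj_eq p q : proj p = proj q <-> param_map a d p = param_map a d q.
Proof.
have -> : (proj p = proj q) <-> (p - q \in @curve_ideal k n a d).
  rewrite Quotient.idealrBE; split; [by move/eqP|by move/eqP].
rewrite unfold_in /param_map raddfB subr_eq0; split; [by move/eqP|by move/eqP].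
Qed.

(** Identifies R with the span of the monomials with exponents in S, so that grading and
    divisibility become conditions on supports. *)
Definition emb (x : R) : {mpoly k[2]} := param_map a d (repr x).

Lemma emb_proj p : emb (proj p) = param_map a d p.
Proof. by apply/curve_proj_eq; rewrite /curve_proj reprK. Qed.

Lemma emb_inj : injective emb.
Proof.
move=> x y; have [p ->] := curve_projP x; have [q ->] := curve_projP y.
by rewrite !emb_proj => /curve_proj_eq.
Qed.

Fact emb_is_zmod_morphism : zmod_morphism emb.
Proof.
move=> x y; have [p ->] := curve_projP x; have [q ->] := curve_projP y.
by rewrite /curve_proj -rmorphB -!/(proj _) !emb_proj /param_map rmorphB.
Qed.

Fact emb_is_monoid_morphism : monoid_morphism emb.
Proof.
split=> [|x y].
  by rewrite -(rmorph1 (\pi_({ideal_quot (@curve_ideal k n a d)}))) -/(proj _)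
    emb_proj /param_map rmorph1.
have [p ->] := curve_projP x; have [q ->] := curve_projP y.
by rewrite /curve_proj -rmorphM -!/(proj _) !emb_proj /param_map rmorphM.
Qed.

HB.instance Definition _ :=
  GRing.isZmodMorphism.Build R {mpoly k[2]} emb emb_is_zmod_morphism.
HB.instance Definition _ :=
  GRing.isMonoidMorphism.Build R {mpoly k[2]} emb emb_is_monoid_morphism.

Lemma embZ (p : {mpoly k[n]}) (x : R) : emb (p *: x) = param_map a d p * emb x.
Proof. by rewrite -emb_proj -rmorphM. Qed.

Lemma in_S_wexp c : S (pt (@wexp n a d c)).
Proof. by exists c; rewrite pt_wexp. Qed.

Lemma wexp_onto m : S (pt m) -> exists c : 'X_{1..n}, wexp a d c = m.
Proof.
move=> [c e]; exists [multinom c i | i < n]; apply: pt_inj.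
by rewrite pt_wexp e; apply: eq_bigr => i _; rewrite mnmE.
Qed.

Lemma emb_supp (D : 'X_{1..n} -> Prop) (D' : 'X_{1..2} -> Prop)
    (p : {mpoly k[n]}) :
  (forall c, D c -> D' (wexp a d c)) -> supp_in D p -> supp_in D' (param_map a d p).
Proof.
move=> DD' Dp; rewrite /param_map {1}(mpolyE p) raddf_sum big_seq.
apply: supp_in_sum => c cp; rewrite /= comp_mpolyZ; apply: supp_inZ.
by rewrite -/(param_map a d _) param_mapX; apply: supp_inX; apply: DD'; apply: Dp.
Qed.

Lemma supp_emb x : supp_in (fun m => S (pt m)) (emb x).
Proof.
have [p ->] := curve_projP x; rewrite emb_proj.
by apply: (emb_supp (D := fun=> True)) => // c _; apply: in_S_wexp.
Qed.

Lemma param_map_onto (D : 'X_{1..n} -> Prop) (q : {mpoly k[2]}) :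
    supp_in (fun m => S (pt m)) q ->
    (forall c, wexp a d c \in msupp q -> D c) ->
  exists2 p : {mpoly k[n]}, supp_in D p & param_map a d p = q.
Proof.
move=> Sq Dq.
have /(_ _ (fun m h => h)) [p Dp pq] : forall s : seq 'X_{1..2},
    (forall m, m \in s -> m \in msupp q) ->
    exists2 p, supp_in D p & param_map a d p = \sum_(m <- s) q@_m *: 'X_[m].
  elim=> [_|m s IH ms].
    by exists 0; rewrite ?big_nil /param_map ?rmorph0 //; apply: supp_in0.
  have [|p Dp pq] := IH; first by move=> m' m's; apply: ms; rewrite inE m's orbT.
  have mq : m \in msupp q by apply: ms; rewrite mem_head.
  have [c cm] := wexp_onto (Sq _ mq).
  exists (q@_m *: 'X_[c] + p).
    by apply: supp_inD => //; apply: supp_inZ; apply: supp_inX; apply: Dq; rewrite cm.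
  rewrite big_cons -pq -cm -[in RHS]param_mapX.
  by rewrite /param_map comp_mpolyD comp_mpolyZ.
by exists p => //; rewrite pq -mpolyE.
Qed.

Lemma emb_onto (q : {mpoly k[2]}) : supp_in (fun m => S (pt m)) q -> exists x : R, emb x = q.
Proof.
move=> Sq; have [//|p _ e] := param_map_onto (D := fun=> True) Sq.
by exists (proj p); rewrite emb_proj.
Qed.

Hypothesis A : curve_exponents n a d.

Lemma mdeg_wexp (c : 'X_{1..n}) : mdeg (wexp a d c) = (mdeg c * d)%N.
Proof.
by apply/in_L_pt; rewrite pt_wexp mdegE; apply: in_L_sum A _.
Qed.

Lemma curve_grP s (x : R) : curve_gr s x <->
  supp_in (fun m => (mdeg m)%:Z = s * d%:Z) (emb x).
Proof.
have d0 : d%:Z != 0 by rewrite -lt0n (d_gt0 A).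
split=> [[p ps ->]|h].
  rewrite emb_proj; apply: (emb_supp (D := fun m => (mdeg m)%:Z = s)) => // c.
  by rewrite mdeg_wexp PoszM => ->.
have [c hc|p ps e] := param_map_onto (D := fun m => (mdeg m)%:Z = s) (@supp_emb x).
  by apply: (mulIf d0); rewrite -PoszM -mdeg_wexp; apply: h.
by exists p => //; apply: emb_inj; rewrite emb_proj.
Qed.

End Embed.

(** * Tor of the coordinate ring *)

Section CurveTor.
Variables (k : fieldType) (n : nat) (a : nat -> nat) (d : nat).
Hypothesis A : curve_exponents n a d.
Local Notation R := (curve_ring k n a d).
Local Notation S := (in_S n a d).
Variable F : free_complex R.
Hypothesis F_graded : is_graded (curve_gr (d := d)) F.
Hypothesis F_res : is_resolution F.
Let n_gt1 : (1 < n)%N. Proof. by case: A. Qed.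
Implicit Types (i j : nat) (y : 'I_n) (Y : {set 'I_n}).

Let row i := 'rV[{mpoly k[n]}]_(rk F i).

(** Its kernel is the image of F_1, so boundaries in F_0 are detected in k[u,v]. *)
Definition psi (v : row 0) : {mpoly k[2]} := emb (augment v).

Fact psi_is_zmod_morphism : zmod_morphism psi.
Proof.
move=> v w; rewrite /psi -rmorphB /augment -sumrB; congr emb.
by apply: eq_bigr => c _; rewrite !mxE scalerBl.
Qed.

HB.instance Definition _ := GRing.isZmodMorphism.Build (row 0) {mpoly k[2]} psi
  psi_is_zmod_morphism.

Lemma psiX y (v : row 0) : psi ('X_y *: v) = 'X_[wexp a d U_(y)] * psi v.
Proof.
rewrite -param_mapX -embZ /psi /augment scaler_sumr; congr emb.
by apply: eq_bigr => c _; rewrite mxE scalerA.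
Qed.

Lemma psi_supp v : supp_in (fun m => S (pt m)) (psi v).
Proof. exact: supp_emb. Qed.

Lemma psi_degs D (v : row 0) : degs D v ->
  supp_in (fun m => exists2 t, D t & (mdeg m)%:Z = t * d%:Z) (psi v).
Proof.
move=> hv; rewrite /psi /augment raddf_sum; apply: supp_in_sum => c _.
rewrite /= embZ.
have hc : supp_in (fun m => exists2 t, D (shift c + t) & (mdeg m)%:Z = t * d%:Z)
    (param_map a d (v 0 c)).
  apply: emb_supp (hv c) => m Dm; exists (mdeg m)%:Z => //.
  by rewrite (mdeg_wexp A).
apply: supp_inM hc ((curve_grP A _ _).1 (F_graded.1 c)) => m1 m2 [t Dt e1] e2.
by exists (shift c + t) => //; rewrite mdegD PoszD e1 e2 -mulrDl addrC.
Qed.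

Lemma psi_of_deg (j : int) (v : row 0) : of_deg j v ->
  supp_in (fun m => (mdeg m)%:Z = j * d%:Z) (psi v).
Proof. by move=> /psi_degs h m /h[_ ->]. Qed.

Lemma psi_in_L (j : int) t (v : row 0) m : of_deg j v -> m \in msupp (psi v) ->
  in_L d t (pt m) -> t%:Z = j.
Proof.
move=> /psi_of_deg h /h /= hm /in_L_pt e; move: hm; rewrite e PoszM => /eqP.
by rewrite (inj_eq (mulIf _)) ?eqz_nat -?lt0n ?(d_gt0 A) // => /eqP.
Qed.

Lemma psi_eq0 v : psi v = 0 -> exists w, v = w *m bd F 0.
Proof.
move=> h; apply/(let: And3 _ h2 _ := F_res in h2).
by apply: (@emb_inj k n a d); rewrite rmorph0.
Qed.

Lemma psi_bd w : psi (w *m bd F 0) = 0.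
Proof.
rewrite /psi; have -> : augment (w *m bd F 0) = 0; last by rewrite rmorph0.
by case: F_res => _ /(_ (w *m bd F 0)) [_ h] _; apply: h; exists w.
Qed.

Lemma psi_eq0_deg (j : int) v : of_deg j v -> psi v = 0 ->
  exists2 w, of_deg j w & v = w *m bd F 0.
Proof.
move=> hv /psi_eq0[w vw]; move: hv; rewrite vw => /(of_deg_preim F_graded).
by case=> w' hw' <-; exists w'.
Qed.

(** Any preimage will do after its components outside degree [j] are dropped: their image lies both
    in degree [j] and outside it. *)
Lemma psi_lift (j : int) (q : {mpoly k[2]}) : supp_in (fun m => S (pt m)) q ->
  supp_in (fun m => (mdeg m)%:Z = j * d%:Z) q ->
  exists2 v, of_deg j v & psi v = q.
Proof.
move=> Sq jq; have [x xq] := emb_onto Sq.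
have [v xv] := let: And3 h _ _ := F_res in h x.
have [v1 [v2 [vE h1 h2]]] := degs_split (fun t => t = j) v.
exists v1 => //; apply/eqP; rewrite eq_sym -subr_eq0; apply/eqP.
have e2 : q - psi v1 = psi v2.
  by rewrite -xq xv -[emb _]/(psi v) vE raddfD /= addrAC subrr add0r.
have /supp_in_eq0 : supp_in (fun m => (mdeg m)%:Z = j * d%:Z) (q - psi v1).
  by apply: supp_inB => //; apply: psi_of_deg.
apply; last by rewrite e2; apply: psi_degs h2.
move=> m /= -> [t nt /eqP].
rewrite (inj_eq (mulIf _)) ?eqz_nat -?lt0n ?(d_gt0 A) // => /eqP e.
by case: nt.
Qed.

Lemma msuppMX_mem (q : {mpoly k[2]}) m0 m :
  (m \in msupp ('X_[m0] * q)) <-> exists2 m', m = (m0 + m')%MM & m' \in msupp q.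
Proof.
rewrite mulrC (perm_mem (msuppMX _ _)); split=> [/mapP[m' m'q ->]|[m' -> m'q]].
  by exists m'.
by apply/mapP; exists m'.
Qed.

Lemma pt_wexpU y : pt (wexp a d U_(y)) = avec a d y.
Proof.
rewrite pt_wexp (bigD1 y) //= mnm1E eqxx mulr1n big1 ?addr0 // => i /negPf ny.
by rewrite mnm1E eq_sym ny mulr0n.
Qed.

Lemma inJ_set0 i (v : row i) : inJ set0 v -> v = 0.
Proof.
move=> h; apply/rowP => c; rewrite mxE; apply: supp_in_eq0 (h c) (h c).
by move=> m [z]; rewrite inE.
Qed.

Lemma tor0_set0 i (j : int) : @tor0 _ _ _ F set0 i.+1 j.
Proof.
move=> v hv /= /inJ_set0 vb.
have [w vw] : exists w, v = w *m bd F i.+1.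
  by case: F_res => _ _ /(_ i v)[+ _]; apply.
move: hv; rewrite vw => /(of_deg_preim F_graded) [w' hw' <-].
by exists w' => //; rewrite subrr; apply: inJ0.
Qed.

(** R embeds in a domain, so x_y is injective on Tor_0 = R; higher up, exactness of F suffices. *)
Lemma tor0_set1 y i (j : int) : @tor0 _ _ _ F [set y] i.+1 j.
Proof.
rewrite -[[set y]]setU0; case: i => [|i]; last first.
  by apply: (tor0_step2 F_graded F_res); rewrite ?inE //; apply: tor0_set0.
apply: (tor0_step F_graded F_res); rewrite ?inE //; last exact: tor0_set0.
move=> w hw _ [u _ /inJ_set0/eqP]; rewrite subr_eq0 => /eqP e.
have [|w' hw' ->] := psi_eq0_deg hw.
  by apply: (@mpolyX_mulI _ _ (wexp a d U_(y))); rewrite -psiX e psi_bd mulr0.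
by exists w' => //; rewrite subrr; apply: inJ0.
Qed.

Lemma card_gt1_rem Y m y0 : #|Y| = m.+2 -> y0 \in Y -> exists y Y',
  [/\ y \notin Y', Y = y |: Y', #|Y'| = m.+1 & y0 \in Y'].
Proof.
move=> cY y0Y; have [y] : exists y, y \in Y :\ y0.
  by apply/set0Pn; rewrite -card_gt0; move: cY; rewrite (cardsD1 y0 Y) y0Y add1n => -[->].
rewrite !inE => /andP[yy0 yY]; exists y, (Y :\ y); split.
- by rewrite !inE eqxx.
- by rewrite setD1K.
- by move: cY; rewrite (cardsD1 y Y) yY add1n => -[].
- by rewrite !inE eq_sym yy0.
Qed.

Lemma card_gt2_rem Y m y0 y1 : #|Y| = m.+3 -> y0 \in Y -> y1 \in Y ->
  exists y Y', [/\ y \notin Y', Y = y |: Y', #|Y'| = m.+2, y0 \in Y' & y1 \in Y'].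
Proof.
move=> cY y0Y y1Y; have [y] : exists y, y \in Y :\ y0 :\ y1.
  apply/set0Pn; rewrite -card_gt0; have := cardsD1 y0 Y; have := cardsD1 y1 (Y :\ y0).
  rewrite cY y0Y => ->; case: (_ \in _); rewrite ?add1n ?add0n; [case=> <- | move=> [<-]]; rewrite ?ltnS //.
rewrite !inE => /and3P[yy1 yy0 yY]; exists y, (Y :\ y); split.
- by rewrite !inE eqxx.
- by rewrite setD1K.
- by move: cY; rewrite (cardsD1 y Y) yY add1n => -[].
- by rewrite !inE eq_sym yy0.
- by rewrite !inE eq_sym yy1.
Qed.

(** Vanishing starts at i = |Y|, one step earlier than the Koszul complex gives, because the first
    variable adjoined is regular on R. *)
Lemma tor0_card m : forall Y i (j : int) y, #|Y| = m.+1 -> y \in Y ->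
  (m < i)%N -> @tor0 _ _ _ F Y i j.
Proof.
elim: m => [|m IH] Y i j y cY yY mi.
  case: i mi => // i _; move/eqP/cards1P: cY => [y' ->]; exact: tor0_set1.
have [y' [Y' [y'Y' -> cY' yY']]] := card_gt1_rem cY yY.
case: i mi => // i mi; apply: (tor0_step2 F_graded F_res) => //; apply: IH cY' yY' _; lia.
Qed.

Variables (y0 yN : 'I_n).
Hypotheses (y0E : y0 = 0%N :> nat) (yNE : yN = n.-1 :> nat).

Let y0N : yN \notin [set y0].
Proof. by rewrite inE -val_eqE /= y0E yNE; have := n_gt1; lia. Qed.

Let pt0 : pt (wexp a d U_(y0)) = avec a d 0. Proof. by rewrite pt_wexpU y0E. Qed.
Let ptN : pt (wexp a d U_(yN)) = avec a d n.-1. Proof. by rewrite pt_wexpU yNE. Qed.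

Let S_m p : S p -> exists m, pt m = p.
Proof. by move=> /(in_S_deg A)[t [? ? _]]; apply: pt_surj. Qed.

Lemma set2_card Y : #|Y| = 2%N -> y0 \in Y -> yN \in Y -> Y = [set y0; yN].
Proof.
move=> cY y0Y yNY; apply/esym/eqP; rewrite eqEcard subUset !sub1set y0Y yNY cY.
by rewrite cardsU1 cards1 inE; have := y0N; rewrite inE eq_sym => ->.
Qed.

Lemma inJ_split1 i y (j : int) (v : row i) : inJ [set y] v -> of_deg j v ->
  exists2 w, of_deg (j - 1) w & v = 'X_y *: w.
Proof.
rewrite -[[set y]]setU0 => Jv /(inJ_split Jv)[w hw /inJ_set0/eqP].
by rewrite subr_eq0 => /eqP ->; exists w.
Qed.

Lemma inJ_split2 i y y' (j : int) (v : row i) : inJ [set y; y'] v -> of_deg j v ->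
  exists w w', [/\ of_deg (j - 1) w, of_deg (j - 1) w' & v = 'X_y *: w + 'X_y' *: w'].
Proof.
move=> Jv hv; have [w hw Jw] := inJ_split Jv hv.
have hXw : of_deg j ('X_y *: w) by rewrite -[j](subrK 1); apply: of_degX.
have [w' hw' e] := inJ_split1 Jw (of_degB hv hXw).
by exists w, w'; split=> //; rewrite -e [RHS]addrC subrK.
Qed.

Variables (e m0 : nat).
Hypothesis E_le : forall s p, in_E n a d p -> in_L d s p -> (s <= e.+1)%N.
Hypothesis AP_le : forall s p, in_AP n a d p -> in_L d s p -> (s <= m0)%N.

Lemma psi_divX y (j : int) (w : row 0) : of_deg j w ->
    (forall m, m \in msupp (psi w) -> S (pt m - avec a d y)) ->
  bdry [set y] j w.
Proof.
move=> hw Sw; have [m mw|g wE Sg] := supp_in_divX (m0 := wexp a d U_(y))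
    (D := fun m => S (pt m) /\ (mdeg m)%:Z = (j - 1) * d%:Z) (p := psi w).
  have [m' m'E] := S_m (Sw m mw); exists m'; last first.
    split; first by rewrite m'E; apply: Sw.
    have := psi_of_deg hw mw; rewrite !mdeg_pt m'E mulrBl mul1r => <-.
    have [_ _] := in_L_avec A (ltn_ord y); rewrite mul1n => <-.
    by rewrite /=; ring.
  by apply: pt_inj; rewrite ptD pt_wexpU m'E addrC subrK.
have [w' hw' gE] := psi_lift (fun m h => (Sg m h).1) (fun m h => (Sg m h).2).
have hXw' : of_deg j ('X_y *: w') by rewrite -[j](subrK 1); apply: of_degX.
have [|u hu wu] := psi_eq0_deg (of_degB hw hXw').
  by rewrite raddfB /= psiX gE wE subrr.
exists u => //; rewrite -wu opprB addrC subrK; apply: inJX_mem; exact: set11.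
Qed.

(** x_(n-1) is injective on R/x_0 R in degree j - 1: a monomial p of psi w violating this would put
    p + a_(n-1) in E_S, in degree j > e + 1. *)
Lemma tor0_pair_1 (j : int) : e%:Z + 1 < j -> @tor0 _ _ _ F [set y0; yN] 1 j.
Proof.
move=> ej; rewrite setUC; apply: (tor0_step F_graded F_res y0N); last exact: tor0_set1.
move=> w hw _ [u hu /inJ_split1 Ju]; apply: psi_divX => // m mw.
have hXw : of_deg j ('X_yN *: w) by rewrite -[j](subrK 1); apply: of_degX.
have [r _ rE] := Ju _ (of_degB hXw (degs_bd F_graded hu)).
have: (wexp a d U_(yN) + m)%MM \in msupp (psi ('X_yN *: w)).
  by rewrite psiX; apply/msuppMX_mem; exists m.
have -> : psi ('X_yN *: w) = psi ('X_y0 *: r).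
  by rewrite -rE raddfB /= psi_bd subr0.
rewrite psiX => /msuppMX_mem[m' /(congr1 pt) + /psi_supp Sm'].
rewrite !ptD pt0 ptN y0E => mm'; apply: contrapT => nS.
have Sm := psi_supp mw.
pose p := pt m + avec a d n.-1.
have Ep : in_E n a d p.
  split; rewrite /p.
  - by apply: in_SD => //; apply: in_S_avec; rewrite -yNE.
  - by rewrite [pt m + _]addrC mm' addrAC subrr add0r.
  - by rewrite addrK.
  - by rewrite addrAC addrK.
have [t Lt] := in_S_deg A Sm.
have := E_le Ep (in_LD Lt (in_L_avec A (_ : (n.-1 < n)%N))).
rewrite -yNE ltn_ord => /(_ isT).
by have := psi_in_L hw mw Lt; lia.
Qed.

(** Monomials divisible by x_0 are split off; the others are divisible by x_(n-1), or they would be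
    points of AP_S in degree [j]. *)
Lemma tor0_pair_0 (j : int) : m0%:Z < j -> @tor0 _ _ _ F [set y0; yN] 0 j.
Proof.
move=> mj v hv _.
pose Q m := `[< S (pt m - avec a d y0) >].
have [||v1 hv1 v1E] := @psi_lift j (mrestrict Q (psi v)).
- by apply: supp_in_mrestrict => m /psi_supp.
- by apply: supp_in_mrestrict => m /(psi_of_deg hv).
have [|u1 hu1 Ju1] := @psi_divX y0 j v1 hv1.
  rewrite v1E => m; rewrite mcoeff_msupp mcoeff_mrestrict.
  by rewrite /Q; case: asboolP; rewrite ?eqxx.
have [|u2 hu2 Ju2] := @psi_divX yN j (v - v1) (of_degB hv hv1).
  rewrite raddfB /= v1E => m mv.
  have [mpv nQm] : m \in msupp (psi v) /\ ~ S (pt m - avec a d y0).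
    move: mv; rewrite mcoeff_msupp mcoeffB mcoeff_mrestrict.
    by rewrite /Q; case: asboolP; rewrite ?subrr ?eqxx // subr0 -mcoeff_msupp.
  apply: contrapT => nN; have Sm := psi_supp mpv; have [t Lt] := in_S_deg A Sm.
  have : in_AP n a d (pt m) by split; rewrite -?yNE -?y0E.
  by move=> /AP_le/(_ Lt); have := psi_in_L hv mpv Lt; lia.
exists (u1 + u2); first by move=> c; rewrite mxE; apply: supp_inD; [apply: hu1|apply: hu2].
have -> : v - (u1 + u2) *m bd F 0 = (v1 - u1 *m bd F 0) + (v - v1 - u2 *m bd F 0).
  by rewrite mulmxDl; apply/rowP => c; rewrite !mxE; ring.
by apply: inJD; [apply: inJS Ju1|apply: inJS Ju2]; rewrite ?subsetUl ?subsetUr.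
Qed.

(** On the line i = |Y| - 1, Tor_i of the set without the last variable vanishes by [tor0_card];
    only Tor_(i-1) contributes, down to Tor_1 of the pair, so AP_S never enters. *)
Lemma tor0_E m : forall Y (j : int), #|Y| = m.+2 -> y0 \in Y -> yN \in Y ->
  m%:Z + 1 + e%:Z < j -> @tor0 _ _ _ F Y m.+1 j.
Proof.
elim: m => [|m IH] Y j cY y0Y yNY ej.
  rewrite (set2_card cY y0Y yNY).
  by apply: tor0_pair_1; lia.
have [y [Y' [yY' -> cY' y0Y' yNY']]] := card_gt2_rem cY y0Y yNY.
apply: (tor0_step2 F_graded F_res) => //; first exact: tor0_card cY' y0Y' _.
by apply: IH => //; lia.
Qed.

Lemma tor0_E_AP m : forall Y i (j : int), #|Y| = m.+2 -> y0 \in Y -> yN \in Y ->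
  i%:Z + (maxn e m0)%:Z < j -> @tor0 _ _ _ F Y i j.
Proof.
elim: m => [|m IH] Y i j cY y0Y yNY ej.
  case: i ej => [|[|i]] ej; last by apply: tor0_card cY y0Y _.
    rewrite (set2_card cY y0Y yNY).
    by apply: tor0_pair_0; lia.
  by apply: tor0_E => //; lia.
have [y [Y' [yY' -> cY' y0Y' yNY']]] := card_gt2_rem cY y0Y yNY.
case: i ej => [|i] ej; first by apply: tor0_step0; apply: IH.
by apply: (tor0_step2 F_graded F_res) => //; apply: IH => //; lia.
Qed.

(** Writing p as a_0 + m1 and as a_(n-1) + m2 gives the syzygy x_(n-1) w2 - x_0 w1, whose lift to
    F_1 is trivial only if p - a_0 - a_(n-1) is in S. By [tor0_E] the next degree vanishes, so the
    class propagates. *)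
Lemma tor_neq0_E m : (exists2 p, in_E n a d p & in_L d e.+1 p) ->
  forall Y, #|Y| = m.+2 -> y0 \in Y -> yN \in Y ->
  exists v : row m.+1, [/\ of_deg (m%:Z + 1 + e%:Z) v, cyc Y v
    & ~ bdry Y (m%:Z + 1 + e%:Z) v].
Proof.
move=> [p Ep Lp]; elim: m => [|m IH] Y cY y0Y yNY; last first.
  have [y [Y' [yY' -> cY' y0Y' yNY']]] := card_gt2_rem cY y0Y yNY.
  have [v [hv cv nv]] := IH Y' cY' y0Y' yNY'.
  have -> : m.+1%:Z + 1 + e%:Z = m%:Z + 1 + e%:Z + 1 by lia.
  by apply: (tor_neq0_step F_graded F_res yY' hv cv nv); apply: tor0_E => //; lia.
rewrite (set2_card cY y0Y yNY) {Y cY y0Y yNY} add0r.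
have [Sp S0 SN nS] := Ep.
have lift q y : S q -> q = p - avec a d y -> exists2 m, pt m = q &
    exists2 w, of_deg e%:Z w & psi w = 'X_[m].
  move=> Sq qp; have [m mq] := S_m Sq; exists m => //.
  have [] : (1 <= e.+1)%N /\ in_L d (e.+1 - 1) q.
    rewrite qp; apply: (in_LB A Lp (in_L_avec A (ltn_ord y))); by rewrite -qp.
  rewrite subn1 -mq => _ /in_L_pt mE; apply: psi_lift.
    by apply: supp_inX; rewrite mq.
  by apply: supp_inX; rewrite mE PoszM.
have [|m1 m1E [w1 hw1 w1E]] := lift _ y0 S0; first by rewrite y0E.
have [|m2 m2E [w2 hw2 w2E]] := lift _ yN SN; first by rewrite yNE.
have hX y w : of_deg e%:Z w -> @of_deg _ _ _ F 0 (1 + e%:Z) ('X_y *: w).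
  by rewrite addrC; apply: of_degX.
pose x := 'X_yN *: w2 - 'X_y0 *: w1.
have [||v hv xE] := @psi_eq0_deg (1 + e%:Z) x; first by apply: of_degB; apply: hX.
  rewrite raddfB /= !psiX w1E w2E -!mpolyXD; apply/eqP; rewrite subr_eq0; apply/eqP.
  congr 'X_[_]; apply: pt_inj; rewrite !ptD pt0 ptN m1E m2E.
  by rewrite addrCA subrr addr0 addrCA subrr addr0.
exists v; split=> //=.
  rewrite -xE; apply: inJB; apply: inJX_mem; by rewrite !inE eqxx ?orbT.
move=> [u hu Ju].
have [v1 [v2 [hv1 hv2 vE]]] := inJ_split2 Ju (of_degB hv (degs_bd F_graded hu)).
have xE2 : x = 'X_y0 *: (v1 *m bd F 0) + 'X_yN *: (v2 *m bd F 0).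
  by rewrite !scalemxAl -mulmxDl -vE mulmxBl (bd_bd F_res) subr0.
(* Comparing the two expressions of [x] makes x_(n-1) (w2 - bd v2) a multiple of x_0; hence x_0
   divides w2 - bd v2, whose image is the monomial m2. *)
have e1 : 'X_yN *: (w2 - v2 *m bd F 0) = 'X_y0 *: (w1 + v1 *m bd F 0).
  rewrite scalerBr scalerDr; apply/eqP; rewrite subr_eq -addrA -xE2 /x.
  by rewrite addrC subrK.
have J2 : inJ [set y0] (w2 - v2 *m bd F 0).
  by apply: (inJX y0N); rewrite e1; apply: inJX_mem; rewrite inE.
rewrite addrAC subrr add0r in hv2.
have [r _ rE] := inJ_split1 J2 (of_degB hw2 (degs_bd F_graded hv2)).
have : m2 \in msupp (psi ('X_y0 *: r)).
  by rewrite -rE raddfB /= psi_bd subr0 w2E msuppX inE.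
rewrite psiX => /msuppMX_mem[m' /(congr1 pt) + /psi_supp Sm'].
rewrite m2E ptD pt0 => h; apply: nS.
by rewrite addrAC h addrAC subrr add0r.
Qed.

(** A point of AP_S is a nonzero class of R/(x_0, x_(n-1)); [e <= m0] puts the next degree beyond
    the bound of [tor0_E_AP], so the class propagates. *)
Lemma tor_neq0_AP m : (e <= m0)%N -> (exists2 p, in_AP n a d p & in_L d m0 p) ->
  forall Y, #|Y| = m.+2 -> y0 \in Y -> yN \in Y ->
  exists v : row m, [/\ of_deg (m%:Z + m0%:Z) v, cyc Y v
    & ~ bdry Y (m%:Z + m0%:Z) v].
Proof.
move=> le_em [p [Sp n0 nN] Lp]; elim: m => [|m IH] Y cY y0Y yNY; last first.
  have [y [Y' [yY' -> cY' y0Y' yNY']]] := card_gt2_rem cY y0Y yNY.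
  have [v [hv cv nv]] := IH Y' cY' y0Y' yNY'.
  have -> : m.+1%:Z + m0%:Z = m%:Z + m0%:Z + 1 by lia.
  apply: (tor_neq0_step F_graded F_res yY' hv cv nv); apply: tor0_E_AP cY' _ _ _ => //.
  by rewrite (maxn_idPr le_em); lia.
rewrite (set2_card cY y0Y yNY) {Y cY y0Y yNY} add0r.
have [m1 m1E] := S_m Sp.
have [||v hv vE] := @psi_lift m0%:Z 'X_[m1]; rewrite -m1E in Sp n0 nN Lp.
- exact: supp_inX.
- by apply: supp_inX; move/in_L_pt: Lp => ->.
exists v; split=> // -[u hu Ju].
have [v1 [v2 [_ _ v12]]] := inJ_split2 Ju (of_degB hv (degs_bd F_graded hu)).
have : m1 \in msupp (psi (v - u *m bd F 0)).
  by rewrite raddfB /= psi_bd subr0 vE msuppX inE.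
rewrite v12 raddfD /= !psiX => /msuppD_le; rewrite mem_cat => /orP[].
- move=> /msuppMX_mem[m' /(congr1 pt) + /psi_supp Sm']; rewrite ptD pt0 => h.
  by apply: n0; rewrite h addrAC subrr add0r.
- move=> /msuppMX_mem[m' /(congr1 pt) + /psi_supp Sm']; rewrite ptD ptN => h.
  by apply: nN; rewrite h addrAC subrr add0r.
Qed.

Hypothesis F_min : is_minimal F.
Hypothesis E_ex : exists2 p, in_E n a d p & in_L d e.+1 p.

Lemma rk_eq0 i : (n <= i)%N -> rk F i = 0%N.
Proof.
move=> ni; case rki: (rk F i) => [//|r].
have b : 'I_(rk F i) by rewrite rki; exact: ord0.
have : betti F i (shift b) = 0%N.
  apply: (tor0_betti F_min); apply: (@tor0_card n.-1 _ _ _ y0); rewrite ?inE //.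
    by rewrite cardsT card_ord; have := n_gt1; lia.
  by have := n_gt1; lia.
by move/eqP; rewrite cards_eq0 => /eqP/setP/(_ b); rewrite !inE eqxx.
Qed.

Let cardT : #|[set: 'I_n]| = n.-2.+2.
Proof. by rewrite cardsT card_ord; have := n_gt1; lia. Qed.

Lemma betti_last_neq0 : betti F n.-1 (n.-1%:Z + e%:Z) != 0%N.
Proof.
have [||v [hv _ nv]] := tor_neq0_E E_ex cardT; rewrite ?inE //.
have := betti_neq0 hv nv.
have -> : n.-2.+1 = n.-1 by have := n_gt1; lia.
by have -> : n.-2%:Z + 1 + e%:Z = n.-1%:Z + e%:Z by have := n_gt1; lia.
Qed.

Lemma betti_last_le (j : int) : betti F n.-1 (n.-1%:Z + j) != 0%N -> j <= e%:Z.
Proof.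
apply: contraNT; rewrite -ltNge => ej; apply/eqP.
have nE : n.-1 = n.-2.+1 by have := n_gt1; lia.
rewrite nE; apply: (tor0_betti F_min); by apply: tor0_E cardT _ _ _; rewrite ?inE //; lia.
Qed.

Lemma betti_le i (j : int) : betti F i j != 0%N -> j - i%:Z <= (maxn e m0)%:Z.
Proof.
apply: contraNT; rewrite -ltNge => ej; apply/eqP.
by apply: (tor0_betti F_min); apply: tor0_E_AP cardT _ _ _; rewrite ?inE //; lia.
Qed.

Lemma betti_AP_neq0 : (exists2 p, in_AP n a d p & in_L d m0 p) -> (e <= m0)%N ->
  betti F n.-2 (n.-2%:Z + m0%:Z) != 0%N.
Proof.
move=> AP_ex em; have [||v [hv _ nv]] := tor_neq0_AP em AP_ex cardT; rewrite ?inE //.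
exact: betti_neq0 hv nv.
Qed.

Lemma projdim_curve p : is_projdim F p -> p = n.-1.
Proof.
move=> [rkp rk0]; apply/eqP; rewrite eqn_leq; apply/andP; split.
  by rewrite leqNgt; apply: contraNN rkp => np; apply/eqP/rk_eq0; lia.
rewrite leqNgt; apply: contraNN betti_last_neq0 => /rk0 r0.
rewrite cards_eq0; apply/eqP/setP => b; exfalso.
by move: (b); rewrite r0 => -[].
Qed.

Lemma regularity_curve (reg : int) : (exists2 p, in_AP n a d p & in_L d m0 p) ->
  is_regularity F reg -> reg = (maxn e m0)%:Z.
Proof.
move=> AP_ex [[i [j [bij ->]]] rmax]; apply: le_anti; rewrite betti_le //=.
have [le_em|le_me] := leqP e m0.
  apply: rmax; exists n.-2, (n.-2%:Z + m0%:Z).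
  by rewrite betti_AP_neq0 // addrAC subrr add0r.
apply: rmax; exists n.-1, (n.-1%:Z + e%:Z).
by rewrite betti_last_neq0 addrAC subrr add0r.
Qed.

End CurveTor.

(** * Hilbert function *)

Section Hilbert.
Variables (k : fieldType) (n : nat) (a : nat -> nat) (d : nat).
Hypothesis A : curve_exponents n a d.
Local Notation R := (curve_ring k n a d).
Local Notation S := (in_S n a d).

(** [s] is an integer so that lines s - 1 and s - 2 always make sense; points with a negative
    coordinate are never in S. *)
Definition line_pt (s : int) (x : nat) : int * int := (x%:Z, s * d%:Z - x%:Z).

(** The cut-off [N] is separate from [s], so that counts on neighbouring lines are sums over one
    range. *)
Definition count_line (Q : int * int -> Prop) (s : int) (N : nat) : nat :=
  \sum_(0 <= x < N) asbool (Q (line_pt s x)).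

Lemma line_ptP s x : S (line_pt s x) -> (x%:Z <= s * d%:Z) /\ exists2 t : nat, s = t & in_L d t (line_pt s x).
Proof.
move=> Sp; have [t Lt] := in_S_deg A Sp; have [_ /= h1 h2] := Lt.
split; first by lia.
exists t => //; apply: (mulIf (_ : d%:Z != 0)); first by rewrite eqz_nat -lt0n (d_gt0 A).
by move: h2; rewrite PoszM => <-; ring.
Qed.

Lemma in_L_line s p : in_L d s p -> exists2 x : nat, (x <= s * d)%N & p = line_pt s%:Z x.
Proof.
case: p => -[x|x] y [] //= _ y0 xy; exists x; first by lia.
by rewrite /line_pt -PoszM -xy addrAC subrr add0r.
Qed.

(** The coefficient matrix [B] of a basis on the monomials of the line is row free by uniqueness of
    coordinates and row full by their existence, hence square. *)
Lemma has_kdim_line (s : int) m N : has_kdim (@curve_gr k n a d s) m ->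
  s * d%:Z < N%:Z -> m = count_line S s N.
Proof.
move=> [b [bV bB]] sN.
pose T := [set x : 'I_N | asbool (S (line_pt s x))].
have -> : count_line S s N = #|T|.
  by rewrite /count_line big_mkord -sum1_card [RHS]big_mkcond /=; apply: eq_bigr => x _; rewrite inE; case: asbool.
have Tpt (j : 'I_#|T|) : S (line_pt s (enum_val j)).
  by have := enum_valP j; rewrite inE => /asboolP.
have /fin_all_exists[mon monE] (j : 'I_#|T|) : exists m, pt m = line_pt s (enum_val j).
  by apply: pt_surj => //=; have [] := line_ptP (Tpt j); lia.
have mon_inj : injective mon.
  by move=> i j /(congr1 pt); rewrite !monE => -[] /val_inj/enum_val_inj.
have mon_deg j : (mdeg (mon j))%:Z = s * d%:Z by rewrite mdeg_pt monE /= addrC subrK.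
have mon_onto q m' : S (pt m') -> (mdeg m')%:Z = s * d%:Z ->
    (forall j, (q : {mpoly k[2]})@_(mon j) = 0) -> q@_m' = 0.
  move=> Sm dm q0.
  have mE : pt m' = line_pt s (m' ord0).
    by rewrite /line_pt -dm mdeg_pt addrAC subrr add0r.
  have [le _] : (m' ord0)%:Z <= s * d%:Z /\ True by split; rewrite // -dm mdeg_pt /=; lia.
  have ltN : (m' ord0 < N)%N by rewrite -ltz_nat; apply: le_lt_trans sN.
  have xT : Ordinal ltN \in T by rewrite inE; apply/asboolP; rewrite -mE.
  suff -> : m' = mon (enum_rank_in xT (Ordinal ltN)) by [].
  by apply: pt_inj; rewrite monE enum_rankK_in.
pose B : 'M[k]_(m, #|T|) := \matrix_(i, j) (emb (b i))@_(mon j).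
have embE (c : 'rV[k]_m) : emb (\sum_i (c 0 i)%:MP *: b i) = \sum_i c 0 i *: emb (b i).
  rewrite raddf_sum; apply: eq_bigr => i _ /=.
  by rewrite embZ /param_map comp_mpolyC mul_mpolyC.
have BE (c : 'rV[k]_m) j : (c *m B) 0 j = (emb (\sum_i (c 0 i)%:MP *: b i))@_(mon j).
  rewrite embE raddf_sum mxE; apply: eq_bigr => i _ /=.
  by rewrite mcoeffZ mxE.
have V0 : curve_gr s (0 : R).
  by exists 0; rewrite ?/curve_proj ?rmorph0 // => m'; rewrite msupp0.
have free : row_free B.
  apply: inj_row_free => c cB.
  have [c0 [_ cu]] := bB 0 V0.
  rewrite -(cu c); last first.
    apply: (@emb_inj k n a d); rewrite rmorph0; apply/mpolyP => m'; rewrite mcoeff0.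
    set q := emb _; have [mq|] := boolP (m' \in msupp q); last by rewrite -mcoeff_eq0 => /eqP ->.
    rewrite mon_onto //; [exact: supp_emb mq| |by move=> j; rewrite -BE cB mxE].
    move: m' mq; rewrite /q embE; apply: supp_in_sum => i _; apply: supp_inZ.
    exact: ((curve_grP A _ _).1 (bV i)).
  by apply: cu; rewrite big1 // => i _; rewrite mxE mpolyC0 scale0r.
have full : row_full B.
  apply/row_fullP.
  have /fin_all_exists[C CE] j : exists c : 'rV[k]_m, c *m B = delta_mx 0 j.
    have [x xE] : exists x : R, emb x = 'X_[mon j].
      by apply: emb_onto; apply: supp_inX; rewrite monE.
    have [|c [cE _]] := bB x.
      by apply/(curve_grP A); rewrite xE; apply: supp_inX.
    exists c; apply/rowP => i; rewrite BE -cE xE mcoeffX mxE eqxx /=.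
    by rewrite (inj_eq mon_inj) eq_sym.
  exists (\matrix_j C j); apply/row_matrixP => j.
  by rewrite row_mul rowK CE rowE mulmx1.
by rewrite -(eqP free) (eqP full).
Qed.

Lemma count_line_stable s N N' : s * d%:Z < N%:Z -> (N <= N')%N ->
  count_line S s N' = count_line S s N.
Proof.
move=> sN NN'; rewrite /count_line (big_cat_nat (leq0n N) NN') /=.
rewrite [X in (_ + X)%N]big_nat [X in (_ + X)%N]big1 ?addn0 // => x /andP[Nx _]; case: asboolP => // /line_ptP[le _]; lia.
Qed.

Lemma count_line_shift s N : s * d%:Z < N%:Z -> (d <= N)%N ->
  (\sum_(0 <= x < N) asbool (S (line_pt s x - avec a d n.-1)%R))%N = count_line S (s - 1) N.
Proof.
move=> sN dN; rewrite (big_cat_nat (leq0n d) dN) /= big_nat big1 => [|x /andP[_ xd]]; last first.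
  case: asboolP => // Sx; have [t [h _ _]] := in_S_deg A Sx.
  by move: h; rewrite (avecN A) /=; lia.
rewrite add0n -{1}[d]add0n big_addn (@count_line_stable _ (N - d)) ?leq_subr //; last by lia.
apply: eq_bigr => x _; congr (nat_of_bool (asbool (S _))).
by rewrite (avecN A) /line_pt /=; congr (_, _) => /=; rewrite ?PoszD; ring.
Qed.

Lemma count_line_rec s N : s * d%:Z < N%:Z -> (d <= N)%N ->
  (count_line S s N)%:Z - (count_line S (s - 1) N)%:Z *+ 2 + (count_line S (s - 2) N)%:Z
  = (count_line (in_AP n a d) s N)%:Z - (count_line (in_E n a d) s N)%:Z.
Proof.
move=> sN dN.
have sE f : (\sum_(0 <= x < N) (f x : bool))%N%:Z = \sum_(0 <= x < N) ((f x : nat)%:Z).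
  by rewrite (big_morph Posz PoszD (erefl _)).
have s1N : (s - 1) * d%:Z < N%:Z by rewrite mulrBl; lia.
have lineB t x : line_pt t x - avec a d 0 = line_pt (t - 1) x.
  by rewrite (avec0 A) /line_pt; congr (_, _) => /=; ring.
(* One copy of the count on line s - 1 is read as the translate by a_(n-1), the other by a_0, which
   keeps the abscissa; the identity then holds point by point. *)
rewrite mulr2n -{2}(count_line_shift sN dN) (_ : s - 2 = s - 1 - 1); last by ring.
rewrite -(count_line_shift s1N dN) /count_line !sE -!(sumrB, big_split) /=.
apply: eq_bigr => x _.
rewrite -!lineB.
have S0 : S (avec a d 0) by apply: in_S_avec; case: A => h _ _ _; lia.
have SN : S (avec a d n.-1) by apply: in_S_avec; case: A => h _ _ _; lia.
set p := line_pt s x.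
have h1 : S (p - avec a d 0 - avec a d n.-1) -> S (p - avec a d 0).
  by move=> /in_SD/(_ SN); rewrite subrK.
have h2 : S (p - avec a d 0 - avec a d n.-1) -> S (p - avec a d n.-1).
  by move=> /in_SD/(_ S0); rewrite addrAC subrK.
have h3 : S (p - avec a d 0) -> S p by move=> /in_SD/(_ S0); rewrite subrK.
have h4 : S (p - avec a d n.-1) -> S p by move=> /in_SD/(_ SN); rewrite subrK.
case: (asboolP (S p)) => b1; case: (asboolP (S (p - avec a d 0))) => b2;
case: (asboolP (S (p - avec a d n.-1))) => b3;
case: (asboolP (S (p - _ - _))) => b4;
case: (asboolP (in_AP n a d p)) => [[? ? ?]|b5];
case: (asboolP (in_E n a d p)) => [[? ? ? ?]|b6]; rewrite //=; try (by exfalso; tauto).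
- by case: b6.
- by case: b5.
Qed.

Lemma poly_eventually0 (P : {poly rat}) (s0 : int) :
  (forall s : int, s0 <= s -> P.[s%:~R] = 0) -> P = 0.
Proof.
move=> h; apply/eqP; apply: contraT => P0.
have := @max_poly_roots _ P [seq (s0 + i%:Z)%:~R | i <- iota 0 (size P)] P0.
rewrite size_map size_iota ltnn; apply.
  by apply/allP => _ /mapP[i _ ->]; apply/rootP/h; lia.
rewrite map_inj_uniq ?iota_uniq // => i j /intr_inj/addrI; by case.
Qed.

Section Regularity.
Variables (e m0 : nat).
Hypothesis E_le : forall s p, in_E n a d p -> in_L d s p -> (s <= e.+1)%N.
Hypothesis AP_le : forall s p, in_AP n a d p -> in_L d s p -> (s <= m0)%N.
Hypothesis E_ex : exists2 p, in_E n a d p & in_L d e.+1 p.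

Lemma count_line_eq0 (Q : int * int -> Prop) (m : nat) s N :
  (forall p, Q p -> S p) -> (forall s p, Q p -> in_L d s p -> (s <= m)%N) ->
  m%:Z < s -> count_line Q s N = 0%N.
Proof.
move=> QS Qm ms; rewrite /count_line big1 // => x _; case: asboolP => // Qx.
have [_ [t st Lt]] := line_ptP (QS _ Qx).
by have := Qm _ _ Qx Lt; lia.
Qed.

(** The second difference of P is eventually, hence identically, zero, so D = H - P has second
    difference |AP_s| - |E_s|. Thus D vanishes from max(e + 1, m0) - 1 on, and if m0 <= e the points
    of E_(e+1) make D(e - 1) nonzero. If e < m0 only a strict bound is claimed: for m0 = e + 1 both
    sets may contribute in degree m0, with opposite signs. *)
Lemma hilbert_regularity_curve r : is_hilbert_regularity (@curve_gr k n a d) r ->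
  ((m0 <= e)%N -> r = e%:Z) /\ ((e < m0)%N -> r < m0%:Z).
Proof.
move=> [H [P [HH [s0 HP] [rP rmin]]]].
pose N (s : int) := (`|s| * d + d + 1)%N.
have sN s : s * d%:Z < (N s)%:Z.
  apply: le_lt_trans (_ : (`|s| * d)%:Z < _); last by rewrite /N; lia.
  by rewrite PoszM; apply: ler_wpM2r => //; lia.
have dN s : (d <= N s)%N by rewrite /N; lia.
have HE s t : t <= s -> (H t)%:Z = (count_line S t (N s))%:Z.
  move=> ts; rewrite (has_kdim_line (HH t) (_ : _ < (N s)%:Z)) //.
  by apply: le_lt_trans (sN s); apply: ler_wpM2r.
pose dl s : int := (count_line (in_AP n a d) s (N s))%:Z - (count_line (in_E n a d) s (N s))%:Z.
have recH s : (H s)%:Z - (H (s - 1))%:Z *+ 2 + (H (s - 2))%:Z = dl s.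
  rewrite /dl -(count_line_rec (sN s) (dN s)).
  by rewrite !(HE s) //; rewrite gerDl.
pose M : int := (maxn e.+1 m0)%:Z.
have dl0 s : M < s -> dl s = 0.
  move=> Ms; move: Ms; rewrite /dl /M => Ms.
  rewrite (count_line_eq0 (Q := in_E n a d) (m := e.+1)) //; [|by move=> p []|lia].
  by rewrite (count_line_eq0 (m := m0)) //; [move=> p []|lia].
pose D s : rat := (H s)%:R - P.[s%:~R].
have Dagree s : hilbert_agree H P s <-> D s = 0.
  by rewrite /hilbert_agree /D; split=> [->|/eqP]; rewrite ?subrr // subr_eq0 => /eqP.
pose Q := P - (P \Po ('X - 1%:P)) *+ 2 + (P \Po ('X - 2%:P)).
have QE s : Q.[s%:~R] = P.[s%:~R] - P.[(s - 1)%:~R] *+ 2 + P.[(s - 2)%:~R].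
  by rewrite /Q !hornerE !horner_comp !hornerE !rmorphB /=.
have Hrat s : (H s)%:R - (H (s - 1))%:R *+ 2 + (H (s - 2))%:R = (dl s)%:~R :> rat.
  by rewrite -recH !rmorphD rmorphN rmorphMn /= !pmulrn.
have Q0 : Q = 0.
  apply: (@poly_eventually0 _ (`|s0| + 2 + `|M| + 1)%:Z) => s hs.
  have hag t : s - 2 <= t -> P.[t%:~R] = (H t)%:R by move=> ht; rewrite HP //; lia.
  by rewrite QE !hag; first rewrite Hrat dl0 //; lia.
have Drec s : D s - D (s - 1) *+ 2 + D (s - 2) = (dl s)%:~R.
  rewrite -Hrat; have := QE s; rewrite Q0 horner0 /D => Qs.
  rewrite -[RHS]subr0 Qs; ring.
(* Descending induction: s + 2 > M, so the recurrence there yields D(s) from D(s + 1) = D(s + 2) =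
   0. *)
have D0 (t : nat) : forall s, s0 - t%:Z <= s -> M - 1 <= s -> D s = 0.
  elim: t => [|t IH] s hs Ms; first by apply/Dagree/HP; lia.
  have := Drec (s + 2); rewrite dl0; last by lia.
  have D2 : D (s + 2) = 0 by apply: IH; lia.
  have D1 : D (s + 2 - 1) = 0 by apply: IH; lia.
  by rewrite D2 D1 addrK mul0rn subrr add0r.
have DM s : M - 1 <= s -> D s = 0.
  by move=> Ms; apply: (D0 `|s0 - s|%N) => //; lia.
split=> em.
  have ME : M = e.+1%:Z by rewrite /M; lia.
  apply: le_anti; rewrite rmin; last by move=> s hs; apply/Dagree/DM; lia.
  rewrite leNgt; apply/negP => re.
  have D1 : D (e%:Z - 1) = 0 by apply/Dagree/rP; lia.
  have := Drec e.+1%:Z.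
  have -> : e.+1%:Z - 1 = e%:Z by lia.
  have -> : e.+1%:Z - 2 = e%:Z - 1 by lia.
  have DMe : D e%:Z = 0 by apply: DM; lia.
  have DMe1 : D e.+1%:Z = 0 by apply: DM; lia.
  rewrite D1 DMe DMe1 mul0rn subr0 addr0 => /esym/eqP.
  rewrite intr_eq0 /dl (count_line_eq0 (m := m0)); [|by move=> p []|by []|lia].
  have [p Ep Lp] := E_ex; have [x lex px] := in_L_line Lp.
  rewrite sub0r oppr_eq0 eqz_nat /count_line big_mkord sum_nat_eq0 => /forallP.
  have ltx : (x < N e.+1)%N by rewrite /N /=; lia.
  by move=> /(_ (Ordinal ltx)) /=; rewrite -px; case: asboolP.
have ME : M = m0%:Z by rewrite /M; lia.
have : r <= m0%:Z - 1 by apply: rmin => s hs; apply/Dagree/DM; lia.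
by lia.
Qed.

End Regularity.

End Hilbert.

(** * Dimension and depth of the coordinate ring *)

Section PolyEval.
Variables (B : nzRingType) (R : comNzRingType) (h : {rmorphism B -> R}) (x : R).

Fact commr_any : commr_rmorph h x. Proof. by move=> b; apply: mulrC. Qed.

Definition evp : {poly B} -> R := horner_morph commr_any.
HB.instance Definition _ := GRing.RMorphism.on evp.

Lemma evpX : evp 'X = x. Proof. exact: horner_morphX. Qed.
Lemma evpC b : evp b%:P = h b. Proof. exact: horner_morphC. Qed.

Lemma evp_poly m (E : nat -> B) :
  evp (\poly_(i < m) E i) = \sum_(i < m) h (E i) * x ^+ i.
Proof.
rewrite poly_def raddf_sum; apply: eq_bigr => i _ /=.
by rewrite -mul_polyC rmorphM rmorphXn /= evpC evpX.
Qed.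

(** One elimination step: factors x are cancelled modulo [I] until the constant term is nonzero;
    since x is in I', so is that term. *)
Lemma evp_cancel (I I' : R -> Prop) (p : {poly B}) :
    is_ideal I' -> (forall y, I y -> I' y) -> I' x ->
    (forall y, I (x * y) -> I y) -> p != 0 -> I (evp p) ->
  exists2 b, b != 0 & I' (h b).
Proof.
move=> [I'0 I'D I'M] II' I'x Icancel.
elim/poly_ind: p => [|p c IH]; first by rewrite eqxx.
rewrite rmorphD rmorphM /= evpX evpC.
have [->|c0 _ Ip] := eqVneq c 0.
  rewrite polyC0 addr0 rmorph0 addr0 => pX0 Ip; apply: IH.
    by apply: contraNneq pX0 => ->; rewrite mul0r.
  by apply: Icancel; rewrite mulrC.
exists c => //; rewrite -[h c](addKr (evp p * x)) addrC; apply: I'D; first exact: II'.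
by rewrite -mulNr; apply: I'M.
Qed.

End PolyEval.

Section AlgebraicDependence.
Variables (k : fieldType).
Local Notation T := {mpoly k[2]}.

Lemma mdeg_mul b1 b2 (f1 f2 : T) : supp_in (fun m => (mdeg m <= b1)%N) f1 ->
  supp_in (fun m => (mdeg m <= b2)%N) f2 ->
  supp_in (fun m => (mdeg m <= b1 + b2)%N) (f1 * f2).
Proof. by apply: supp_inM => m1 m2 h1 h2; rewrite mdegD; apply: leq_add. Qed.

Lemma mdeg_exp e (f : T) i : supp_in (fun m => (mdeg m <= e)%N) f ->
  supp_in (fun m => (mdeg m <= i * e)%N) (f ^+ i).
Proof.
move=> fe; elim: i => [|i IH].
  by rewrite expr0 => m; rewrite msupp1 inE => /eqP->; rewrite mdeg0.
rewrite exprS mulSn; apply: mdeg_mul fe IH.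
Qed.

(* Counting: (N+1)^3 products in a space of dimension O(N^2). *)
Lemma mpoly2_dependence (f1 f2 f3 : T) : exists N (c : 'I_N.+1 * 'I_N.+1 * 'I_N.+1 -> k),
  (exists i, c i != 0) /\
  \sum_i c i *: (f1 ^+ i.1.1 * f2 ^+ i.1.2 * f3 ^+ i.2) = 0.
Proof.
pose e := maxn (maxn (msize f1) (msize f2)) (msize f3).
have le (f : T) : (msize f <= e)%N -> supp_in (fun m => (mdeg m <= e)%N) f.
  by move=> fe m /msize_mdeg_lt; lia.
(* Each product has degree at most 3 N0 e < W, so at most W^2 monomials occur; W <= N (3 e + 1) and
   (3 e + 1)^2 < N give W^2 < N^3. *)
pose N0 := ((3 * e + 1) ^ 2)%N; pose N := N0.+1; pose W := (3 * N0 * e + 1)%N.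
pose I : finType := ('I_N * 'I_N * 'I_N)%type; pose J : finType := ('I_W * 'I_W)%type.
pose F (i : I) := f1 ^+ i.1.1 * f2 ^+ i.1.2 * f3 ^+ i.2.
have degF i : supp_in (fun m => (mdeg m < W)%N) (F i).
  have [e1 e2 e3] : [/\ msize f1 <= e, msize f2 <= e & msize f3 <= e]%N.
    by split; rewrite /e; lia.
  have h := mdeg_mul (mdeg_mul (mdeg_exp (i := i.1.1) (le f1 e1))
    (mdeg_exp (i := i.1.2) (le f2 e2))) (mdeg_exp (i := i.2) (le f3 e3)).
  move=> m /h h'; apply: leq_ltn_trans h' _.
  rewrite -!mulnDl /W addn1 ltnS leq_mul //.
  have := ltn_ord i.1.1; have := ltn_ord i.1.2; have := ltn_ord i.2.
  by rewrite /N !ltnS => l3 l2 l1; clear -l1 l2 l3; lia.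
pose mon (j : J) : 'X_{1..2} := [multinom if t == ord0 then j.1 : nat else j.2 | t < 2].
pose M : 'M[k]_(#|I|, #|J|) := \matrix_(i, j) (F (enum_val i))@_(mon (enum_val j)).
have ltJI : (#|J| < #|I|)%N.
  rewrite !card_prod !card_ord.
  have: (W <= N * (3 * e + 1))%N by rewrite /W /N; nia.
  move=> leW; apply: leq_ltn_trans (leq_mul leW leW) _.
  by rewrite mulnACA -/(N * N)%N ltn_pmul2l ?muln_gt0 //.
have kerM : kermx M != 0.
  by rewrite -mxrank_eq0 mxrank_ker subn_eq0 -ltnNge; apply: leq_ltn_trans (rank_leq_col _) _.
pose v := nz_row (kermx M).
have v0 : v != 0 by rewrite nz_row_eq0.
have vM : v *m M = 0 by apply/sub_kermxP/nz_row_sub.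
exists N0, (fun i => v 0 (enum_rank i)); split.
  have /rV0Pn[i vi] := v0; exists (enum_val i).
  by rewrite enum_valK.
apply/mpolyP => m; rewrite mcoeff0 raddf_sum /=.
have [mW|mW] := ltnP (mdeg m) W; last first.
  rewrite big1 // => i _; rewrite mcoeffZ (memN_msupp_eq0 (p := F i)) ?mulr0 //.
  by apply: contraL mW => /degF; rewrite -ltnNge.
have [l0 l1] : (m ord0 < W)%N /\ (m ord_max < W)%N.
  by move: mW; rewrite mdegE big_ord_recl big_ord1 (_ : lift _ _ = ord_max); [lia|apply: val_inj].
pose j : J := (Ordinal l0, Ordinal l1).
have mE : m = mon j.
  by apply: pt_inj; rewrite /pt /mon !mnmE.
move/rowP/(_ (enum_rank j)): vM; rewrite !mxE.
rewrite (reindex (@enum_rank I)) /=; last by exists enum_val => ? _; rewrite ?enum_rankK ?enum_valK.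
move=> h; rewrite -[RHS]h; apply: eq_bigr => i _.
by rewrite mxE !enum_rankK -mE mcoeffZ.
Qed.

End AlgebraicDependence.

Section Ideals.
Variable R : comNzRingType.
Implicit Types (I J : R -> Prop) (s : seq R).

Lemma generated_ideal_sub I s : is_ideal I -> (forall x, x \in s -> I x) ->
  forall x, generated_ideal s x -> I x.
Proof.
move=> [I0 ID IM] sI x [c ->]; elim/big_ind: _ => // i _.
by apply/IM/sI/mem_nth.
Qed.

Lemma generated_ideal_ideal s : is_ideal (generated_ideal s).
Proof.
split=> [|_ _ [c ->] [c' ->]|r _ [c ->]].
- by exists (fun=> 0); rewrite big1 // => i _; rewrite mul0r.
- by exists (fun i => c i + c' i); rewrite -big_split; apply: eq_bigr => i _; rewrite mulrDl.
- by exists (fun i => r * c i); rewrite mulr_sumr; apply: eq_bigr => i _; rewrite mulrA.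
Qed.

Lemma mem_generated_ideal s x : x \in s -> generated_ideal s x.
Proof.
move=> xs; have ltx : (index x s < size s)%N by rewrite index_mem.
exists (fun i => (i == Ordinal ltx)%:R).
rewrite (bigD1 (Ordinal ltx)) //= eqxx mul1r nth_index // big1 ?addr0 // => i /negPf ->.
by rewrite mul0r.
Qed.

Lemma generated_ideal_nil x : generated_ideal (Nil R) x -> x = 0.
Proof. by move=> [c ->]; rewrite big_ord0. Qed.

End Ideals.

Section CurveDimension.
Variables (k : fieldType) (n : nat) (a : nat -> nat) (d : nat).
Local Notation R := (curve_ring k n a d).

Definition cst (c : k) : R := @curve_proj k n a d c%:MP.

Fact cst_is_zmod_morphism : zmod_morphism cst.
Proof. by move=> c c'; rewrite /cst mpolyCB /curve_proj rmorphB. Qed.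
Fact cst_is_monoid_morphism : monoid_morphism cst.
Proof.
by split=> [|c c']; rewrite /cst /curve_proj ?mpolyC1 ?rmorph1 // mpolyCM rmorphM.
Qed.
HB.instance Definition _ := GRing.isZmodMorphism.Build k R cst cst_is_zmod_morphism.
HB.instance Definition _ := GRing.isMonoidMorphism.Build k R cst cst_is_monoid_morphism.

Lemma emb_cst c : emb (cst c) = c%:MP.
Proof. by rewrite /cst emb_proj /param_map comp_mpolyC. Qed.

Lemma curve_mulf0 (x y : R) : x * y = 0 -> x = 0 \/ y = 0.
Proof.
move/(congr1 (@emb k n a d)); rewrite rmorphM rmorph0 => /eqP.
rewrite mulf_eq0 => /orP[]/eqP h; [left|right]; apply: (@emb_inj k n a d); by rewrite rmorph0.
Qed.

Lemma curve_algebraic_relation (f1 f2 f3 : R) : exists2 p : {poly {poly {poly k}}},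
  p != 0 & evp (evp (evp cst f3) f2) f1 p = 0.
Proof.
have [N [c [[i ci] crel]]] := mpoly2_dependence (emb f1) (emb f2) (emb f3).
exists (\poly_(i < N.+1) \poly_(j < N.+1) \poly_(l < N.+1) c (inord i, inord j, inord l)).
  apply: contraNneq ci => /polyP/(_ i.1.1); rewrite coef_poly coef0 ltn_ord.
  move=> /polyP/(_ i.1.2); rewrite coef_poly coef0 ltn_ord.
  move=> /polyP/(_ i.2); rewrite coef_poly coef0 ltn_ord !inord_val => <-.
  by case: i => -[].
have sumE : \sum_i c i *: (emb f1 ^+ i.1.1 * emb f2 ^+ i.1.2 * emb f3 ^+ i.2) =
    \sum_i1 \sum_i2 \sum_i3 c (i1, i2, i3) *: (emb f1 ^+ i1 * emb f2 ^+ i2 * emb f3 ^+ i3).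
  by rewrite pair_bigA pair_bigA; apply: eq_bigr => -[[i1 i2] i3].
apply: (@emb_inj k n a d); rewrite rmorph0 -crel sumE evp_poly raddf_sum.
apply: eq_bigr => i1 _; rewrite /= rmorphM rmorphXn /= evp_poly raddf_sum mulr_suml.
apply: eq_bigr => i2 _; rewrite /= rmorphM rmorphXn /= evp_poly raddf_sum !mulr_suml.
apply: eq_bigr => i3 _; rewrite /= rmorphM rmorphXn /= emb_cst !inord_val -mul_mpolyC.
by rewrite -!mulrA; congr (_ * _); rewrite mulrC (mulrC (emb f2 ^+ _)) -mulrA.
Qed.

(** The relation is stripped of f1, f2, f3 in turn, leaving a nonzero constant of k in I3.
    Cancellation modulo the previous ideal holds along prime chains and regular sequences alike, so
    both bounds by 2 follow. *)
Lemma curve_dim_le2 (I1 I2 I3 : R -> Prop) f1 f2 f3 :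
    is_ideal I1 -> is_ideal I2 -> is_ideal I3 ->
    (forall x, I1 x -> I2 x) -> (forall x, I2 x -> I3 x) ->
    f1 != 0 -> I1 f1 -> I2 f2 -> I3 f3 ->
    (forall y, I1 (f2 * y) -> I1 y) -> (forall y, I2 (f3 * y) -> I2 y) ->
  I3 1.
Proof.
move=> id1 id2 id3 I12 I23 f10 If1 If2 If3 can2 can3.
have [p p0 pE] := curve_algebraic_relation f1 f2 f3.
have [||q q0 Iq] := evp_cancel (I := eq^~ 0) (x := f1) id1 _ If1 _ p0 pE.
- by move=> _ ->; case: id1.
- by move=> y /curve_mulf0[/eqP|//]; rewrite (negPf f10).
have [c c0 Ic] := evp_cancel id2 I12 If2 can2 q0 Iq.
have [b b0 Ib] := evp_cancel id3 I23 If3 can3 c0 Ic.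
have -> : 1 = cst b^-1 * cst b by rewrite -rmorphM mulVf ?rmorph1.
by case: id3 => _ _; apply.
Qed.

Lemma prime_chain_le2 (P : R -> Prop) l c : prime_chain P l c -> (l <= 2)%N.
Proof.
move=> [cP cS _]; rewrite leqNgt; apply/negP => l3.
have id i : (i <= 3)%N -> is_prime_ideal (c i) by move=> i3; apply: cP; lia.
have [[id0 _ _] [id1 _ p1] [id2 _ p2] [id3 c31 _]] := And4 (id 0%N isT) (id 1%N isT) (id 2%N isT) (id 3%N isT).
have [_ [f1 [f11 f10]]] := cS 0%N (ltn_trans (isT : 0 < 2)%N l3).
have [c12 [f2 [f22 f21]]] := cS 1%N (ltn_trans (isT : 1 < 2)%N l3).
have [c23 [f3 [f33 f32]]] := cS 2%N l3.
apply: c31; apply: (curve_dim_le2 id1 id2 id3 c12 c23 _ f11 f22 f33).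
- by apply/eqP => f1E; apply: f10; rewrite f1E; case: id0.
- by move=> y /p1[].
- by move=> y /p2[].
Qed.

Lemma regular_sequence_le2 (s : seq R) : regular_sequence s -> (size s <= 2)%N.
Proof.
move=> [reg s1]; rewrite leqNgt; apply/negP => s3; apply: s1.
have sub i j : (i <= j)%N -> forall x, generated_ideal (take i s) x -> generated_ideal (take j s) x.
  move=> ij; apply: generated_ideal_sub; first exact: generated_ideal_ideal.
  move=> x xs; apply: mem_generated_ideal.
  by rewrite -(subnKC ij) takeD mem_cat xs.
have mem i : (i < size s)%N -> generated_ideal (take i.+1 s) s`_i.
  by move=> lt; apply: mem_generated_ideal; rewrite (take_nth 0) // mem_rcons mem_head.
have l2 := ltnW s3; have l1 := ltnW l2.
rewrite -[s]take_size; apply: (sub 3 _ s3).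
apply: (curve_dim_le2 _ _ _ (sub 1%N 2 isT) (sub 2 3 isT) _ (mem 0%N l1) (mem 1%N l2) (mem 2 s3));
  rewrite ?take0; try exact: generated_ideal_ideal; try exact: reg.
apply/eqP => s0; have := reg 0%N l1 1; rewrite take0 s0 mul0r => h.
have [h0 _ _] := generated_ideal_ideal (Nil R).
by have /generated_ideal_nil/eqP := h h0; rewrite oner_eq0.
Qed.

End CurveDimension.

(** * Maximal ideals *)

Section Zariski.

Lemma infinite_nonroot (k : fieldType) (p : {poly k}) : infinite_type k -> p != 0 ->
  exists x, p.[x] != 0.
Proof.
move=> kinf p0; apply: contrapT => noroot.
have rootp x : root p x.
  by apply/rootP; apply: contrapT => px; apply: noroot; exists x; apply/eqP.
have [s us ss] : exists2 s : seq k, uniq s & size s = size p.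
  elim: (size p) => [|m [s us ss]]; first by exists [::].
  by have [x xs] := kinf s; exists (x :: s); rewrite /= ?xs ?ss.
have sr : all (root p) s by apply/allP.
by have := max_poly_roots p0 sr us; rewrite ss ltnn.
Qed.

(* A field K finitely generated over k cannot contain the polynomial ring k[s]:
   if t is algebraic over k[s] and K is integral over k[s, t], then K is integral
   over k[s][1/c] with c the leading coefficient of a relation for t, whereas
   1/(s - l) is not when l is not a root of c. *)
Lemma zariski (k : fieldType) (K : comNzRingType) (h : {rmorphism {poly k} -> K})
    (t : K) (p : {poly {poly k}}) : infinite_type k ->
    (forall z : K, z != 0 -> exists w, z * w = 1) -> p != 0 -> evp h t p = 0 ->
    (forall c', (forall b, integralOver (evp h c') (h b)) ->
       integralOver (evp h c') t -> integralRange (evp h c')) ->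
  exists2 f, f != 0 & h f = 0.
Proof.
move=> kinf Kf p0 pt Kint; apply: contrapT => h_inj.
have {}h_inj f : h f = 0 -> f = 0.
  by move=> hf; apply: contrapT => /eqP f0; apply: h_inj; exists f.
pose c := lead_coef p.
have c0 : c != 0 by rewrite lead_coef_eq0.
have hc0 : h c != 0 by apply: contraNneq c0 => /h_inj ->.
have [c' cc'] := Kf _ hc0.
have hint b : integralOver (evp h c') (h b).
  by rewrite -(evpC h c' b); apply: integral_id.
have c'int : integralOver (evp h c') c'.
  by rewrite -{2}(evpX h c'); apply: integral_id.
have tint : integralOver (evp h c') t.
  apply: (integral_root_monic (p := c' *: map_poly h p)).
  - rewrite monicE lead_coef_lreg; first by rewrite lead_coef_map_eq // mulrC cc'.
    by move=> y z /(congr1 ( *%R (h c))); rewrite !mulrA cc' !mul1r.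
  - by move: pt; rewrite /root hornerZ /evp /horner_morph => ->; rewrite mulr0.
  - apply/integral_poly => i; rewrite coefZ coef_map; exact: integral_mul c'int (hint _).
have [l cl] := infinite_nonroot kinf c0.
pose E : {poly k} := 'X - l%:P.
have [w Ew] : exists w, h E * w = 1.
  by apply: Kf; apply: contraFneq (polyXsubC_eq0 l) => /h_inj h0; apply/eqP.
have [q mq /rootP qw] := Kint c' hint tint w.
(* The monic equation of w = 1/E over k[s][1/c], multiplied by E^m with m its degree, becomes 1 + E
   z = 0; the variable of [z] stands for 1/c. *)
have [z zE] : exists z, evp h c' (1 + E%:P * z) = 0.
  pose m := (size q).-1.
  have sq : size q = m.+1 by rewrite prednK // lt0n size_poly_eq0 monic_neq0.
  exists (\sum_(i < m) q`_i * (E ^+ (m - i.+1))%:P).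
  move/(congr1 ( *%R (h E ^+ m))): qw; rewrite mulr0 => <-.
  rewrite horner_coef size_map_poly_id0; last first.
    by rewrite (monicP mq) rmorph1 oner_eq0.
  rewrite sq big_ord_recr /= mulrDr coef_map /=.
  have -> : q`_m = 1 by rewrite -(monicP mq) lead_coefE.
  rewrite rmorph1 mul1r -exprMn Ew expr1n addrC rmorphD rmorph1; congr (_ + 1).
  rewrite rmorphM /= evpC raddf_sum !mulr_sumr.
  apply: eq_bigr => i _; rewrite coef_map /= rmorphM /= evpC rmorphXn.
  have hEi : h E ^+ m = h E * h E ^+ (m - i.+1) * h E ^+ i.
    by rewrite -exprS -exprD -subSn // subSS subnK // ltnW.
  have : h E ^+ i * w ^+ i = 1 by rewrite -exprMn Ew expr1n.
  rewrite hEi; move: (h E ^+ i) (w ^+ i) => x y xy; ring: xy.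
(* c^N clears the denominators, so g = 0 in k[s]. At l, where E vanishes, only the coefficient of
   index 0 in [y] survives, and it is 1; so g(l) = c(l)^N, which is nonzero. *)
pose y := 1 + E%:P * z; pose N := size y.
pose g := \sum_(j < N) y`_j * c ^+ (N - j).
have g0 : g = 0.
  apply: h_inj; rewrite -[RHS](mul0r (h c ^+ N)) -zE -/y.
  rewrite /evp /horner_morph horner_poly raddf_sum mulr_suml.
  apply: eq_bigr => j _; rewrite /= rmorphM rmorphXn /=.
  have hcj : h c ^+ N = h c ^+ (N - j) * h c ^+ j by rewrite -exprD subnK // ltnW.
  have : h c ^+ j * c' ^+ j = 1 by rewrite -exprMn cc' expr1n.
  rewrite hcj; move: (h c ^+ j) (c' ^+ j) (h c ^+ (N - j)) => u v u' uv.
  by rewrite -[LHS]mulr1 -uv -!mulrA; congr (_ * _); ring.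
have yl j : (y`_j).[l] = (j == 0%N)%:R.
  by rewrite /y coefD coef1 coefCM hornerD hornerM hornerXsubC subrr mul0r addr0; case: eqP => _; rewrite hornerE.
have N0 : (0 < N)%N.
  rewrite lt0n size_poly_eq0; apply/eqP => y0; have := yl 0%N.
  by rewrite y0 coef0 horner0 => /eqP; rewrite eq_sym oner_eq0.
move/(congr1 (fun f => f.[l])): g0; rewrite horner0 /g horner_sum.
rewrite (bigD1 (Ordinal N0)) //= big1 => [|j j0].
  by rewrite addr0 hornerM yl mul1r horner_exp subn0 => /eqP; rewrite expf_eq0 (negPf cl) andbF.
by rewrite hornerM yl (_ : (j == 0%N :> nat) = false) ?mul0r //; apply: negbTE.
Qed.

End Zariski.

Lemma maximal_ideal_inv (R : comNzRingType) (P : R -> Prop) x :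
  is_maximal_ideal P -> ~ P x -> exists w, P (x * w - 1).
Proof.
move=> [[P0 PD PM] P1 Pmax] Px; pose J z := exists u w, P u /\ z = u + x * w.
have PN u : P u -> P (- u) by move=> ?; rewrite -mulN1r; apply: PM.
have [J1|J1] := EM (J 1).
  have [u [w [Pu ->]]] := J1; exists w; rewrite opprD addrC addrNK; exact: PN.
case: Px; apply: (Pmax J) => //.
- split=> [|_ _ [u [w [Pu ->]]] [u' [w' [Pu' ->]]]|r _ [u [w [Pu ->]]]].
  + by exists 0, 0; rewrite mulr0 addr0.
  + by exists (u + u'), (w + w'); split; [apply: PD|ring].
  + by exists (r * u), (r * w); split; [apply: PM|ring].
- by move=> u Pu; exists u, 0; rewrite mulr0 addr0.
- by exists 0, 1; rewrite mulr1 add0r.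
Qed.

Lemma maximal_ideal_prime (R : comNzRingType) (P : R -> Prop) :
  is_maximal_ideal P -> is_prime_ideal P.
Proof.
move=> Pmax; have [[P0 PD PM] P1 _] := Pmax; split=> // x y Pxy.
have [Px|/(maximal_ideal_inv Pmax)[w Pw]] := EM (P x); first by left.
right; have -> : y = w * (x * y) + (- y) * (x * w - 1) by ring.
by apply: PD; apply: PM.
Qed.

Lemma pair_mulrn (x y : int) m : (x, y) *+ m = (x * m%:Z, y * m%:Z).
Proof.
elim: m => [|m IH]; first by rewrite mulr0n !mulr0.
by rewrite mulrS IH; congr (_, _) => /=; rewrite intS; ring.
Qed.

Section MaximalIdeal.
Variables (k : fieldType) (n : nat) (a : nat -> nat) (d : nat).
Hypothesis A : curve_exponents n a d.
Hypothesis k_inf : infinite_type k.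
Local Notation R := (curve_ring k n a d).
Variable P : R -> Prop.
Hypothesis P_max : is_maximal_ideal P.

Definition maxi : {pred R} := fun x => asbool (P x).

Fact maxi_closed : idealr_closed maxi.
Proof.
have [[P0 PD PM] P1 _] := P_max; split; rewrite ?unfold_in; first exact/asboolP.
  by apply/asboolP.
move=> r x y; rewrite !unfold_in => /asboolP Px /asboolP Py; apply/asboolP.
by apply: PD => //; apply: PM.
Qed.

HB.instance Definition _ := isIdealr.Build R maxi maxi_closed.

Definition residue_field : Type := {ideal_quot maxi}.
HB.instance Definition _ := GRing.ComNzRing.on residue_field.

Definition residue : {rmorphism R -> residue_field} :=
  (\pi_({ideal_quot maxi}) : {rmorphism R -> {ideal_quot maxi}}).

Lemma residue_eq0 x : residue x = 0 <-> P x.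
Proof.
rewrite -(rmorph0 residue); split=> [/eqP|Px].
  by rewrite -[_ == _]Quotient.idealrBE subr0 => /asboolP.
by apply/eqP; rewrite -[_ == _]Quotient.idealrBE subr0; apply/asboolP.
Qed.

Lemma residue_surj z : exists x, residue x = z.
Proof. by exists (repr (z : {ideal_quot maxi})); apply: reprK. Qed.

Lemma residue_inv (z : residue_field) : z != 0 -> exists w, z * w = 1.
Proof.
have [x <-] := residue_surj z => /eqP xP.
have [|w Pw] := maximal_ideal_inv P_max (x := x); first by move/residue_eq0.
exists (residue w); apply/eqP; rewrite -subr_eq0 -rmorphM -(rmorph1 residue) -rmorphB.
exact/eqP/residue_eq0.
Qed.

Definition xgen (i : 'I_n) : R := @curve_proj k n a d 'X_i.

Lemma emb_xgen i : emb (xgen i) = 'X_[wexp a d U_(i)].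
Proof. by rewrite emb_proj param_mapX. Qed.

Lemma xgen_relation i (i0 iN : 'I_n) : i0 = 0%N :> nat -> iN = n.-1 :> nat ->
  xgen i ^+ d = xgen i0 ^+ (d - a i) * xgen iN ^+ a i.
Proof.
move=> e0 eN; apply: (@emb_inj k n a d).
rewrite rmorphM !rmorphXn /= !emb_xgen !mpolyXn -mpolyXD; congr 'X_[_].
apply: pt_inj; rewrite ptD !ptMn !pt_wexpU e0 eN (avec0 A) (avecN A) /avec.
have := a_le_d A (ltn_ord i) => le.
by rewrite !pair_mulrn; congr (_, _) => /=; lia.
Qed.

(** x_i is a root of X^d - x_0^(d - a_i) x_(n-1)^(a_i), so integrality of the two end variables
    suffices. *)
Lemma residue_integral (B : comNzRingType) (h : {rmorphism B -> residue_field}) :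
  (forall c, integralOver h (residue (cst n a d c))) ->
  (forall i : 'I_n, i = 0%N :> nat \/ i = n.-1 :> nat -> integralOver h (residue (xgen i))) ->
  integralRange h.
Proof.
move=> hc hx.
have n1 : (1 < n)%N by case: A.
pose i0 : 'I_n := Ordinal (ltnW n1); have ltN : (n.-1 < n)%N by lia.
pose iN : 'I_n := Ordinal ltN.
have intX z m : integralOver h z -> integralOver h (z ^+ m).
  move=> iz; elim: m => [|m IH]; first by rewrite expr0; apply: (integral1 h).
  by rewrite exprS; apply: (integral_mul iz IH).
have hxi i : integralOver h (residue (xgen i)).
  apply: (integral_root_monic (p := 'X^d - (residue (xgen i ^+ d))%:P)).
  - by apply: monicXnsubC; apply: d_gt0 A.
  - by rewrite /root !hornerE rmorphXn subrr.
  - apply/integral_poly => j; rewrite coefB coefXn coefC.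
    apply: integral_sub; first by case: eqP => _; [apply: integral1|apply: integral0].
    case: eqP => _; last exact: integral0.
    rewrite (@xgen_relation i i0 iN) // rmorphM !rmorphXn.
    by apply: integral_mul; apply: intX; apply: hx; [left|right].
move=> z; have [x <-] := residue_surj z; have [p ->] := curve_projP x.
rewrite (mpolyE p) /curve_proj rmorph_sum raddf_sum.
elim/big_ind: _ => [||m _]; [exact: integral0|exact: integral_add|].
rewrite -mul_mpolyC mpolyXE_id /= !rmorphM; apply: integral_mul; first exact: hc.
rewrite rmorph_prod; rewrite rmorph_prod; elim/big_ind: _ => [||i _]; [exact: integral1|exact: integral_mul|].
rewrite /= !rmorphXn; exact/intX/hxi.
Qed.

Lemma evp_residue (B : nzRingType) (g : {rmorphism B -> R}) (x : R) p :
  evp (residue \o g) (residue x) p = residue (evp g x p).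
Proof. by rewrite /evp /horner_morph -horner_map map_poly_comp. Qed.

Lemma emb_xgen_unit i w : xgen i * w <> 1.
Proof.
have c0 : (emb (xgen i * w))@_0%MM = 0.
  apply/eqP; rewrite mcoeff_eq0 rmorphM /= emb_xgen.
  apply/negP => /msuppMX_mem[m' /esym/eqP]; rewrite mnmD_eq0 => /andP[/eqP h _] _.
  have := mdeg_wexp A U_(i); rewrite h mdeg0 mdeg1 mul1n.
  by have := d_gt0 A; case: (d).
move=> xw; move: c0; rewrite xw rmorph1 mcoeff1 eqxx => /eqP.
by rewrite oner_eq0.
Qed.

(** If x_i is not in P, some x_i w - 1 is in P, and it is nonzero as x_i is no unit of R.
    Eliminating it from its relation with x_j and x_i makes x_j algebraic over k[x_i] in the residue
    field, as [zariski] requires. *)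
Lemma maximal_ideal_poly (i j : 'I_n) :
    i = 0%N :> nat /\ j = n.-1 :> nat \/ j = 0%N :> nat /\ i = n.-1 :> nat ->
  exists2 f, f != 0 & P (evp (cst n a d) (xgen i) f).
Proof.
move=> ij; have [idP _ _] := P_max.
have [Px|/(maximal_ideal_inv P_max)[w Pg]] := EM (P (xgen i)).
  by exists 'X; rewrite ?polyX_eq0 ?evpX.
set g := _ - 1 in Pg.
have g0 : g != 0 by rewrite subr_eq0; apply/eqP/emb_xgen_unit.
have [p p0 pE] := curve_algebraic_relation g (xgen j) (xgen i).
have [||q q0 Pq] := evp_cancel (I := eq^~ 0) (x := g) idP _ Pg _ p0 pE.
- by move=> _ ->; case: idP.
- by move=> y /curve_mulf0[/eqP|//]; rewrite (negPf g0).
have [||f f0 /residue_eq0] := zariski (h := residue \o evp (cst n a d) (xgen i))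
    (t := residue (xgen j)) k_inf residue_inv q0; last by exists f.
- by rewrite evp_residue; apply/residue_eq0.
move=> c' hb ht; apply: residue_integral => [c|i' hi'].
  by have := hb c%:P; rewrite /= evpC.
have [->|->//] : i' = i \/ i' = j.
  by case: ij hi' => -[ei ej] [] e; [left|right|right|left]; apply: val_inj; rewrite /= e ?ei ?ej.
by have := hb 'X; rewrite /= evpX.
Qed.

End MaximalIdeal.

(** * Regular sequences when E is empty *)

Lemma seq_argmax (T : eqType) (f : T -> nat) (s : seq T) : s != [::] ->
  exists2 x, x \in s & forall y, y \in s -> (f y <= f x)%N.
Proof.
elim: s => // x s IH _; have [->|/IH[y ys ymax]] := eqVneq s [::].
  by exists x; rewrite ?mem_head // => y; rewrite inE => /eqP ->.
have [le_xy|lt_yx] := leqP (f x) (f y).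
  by exists y => [|z]; rewrite inE ?ys ?orbT // => /orP[/eqP->|/ymax].
exists x => [|z]; rewrite ?mem_head // inE => /orP[/eqP->//|/ymax zy].
exact: leq_trans zy (ltnW lt_yx).
Qed.

Section RegularPair.
Variables (k : fieldType) (n : nat) (a : nat -> nat) (d : nat).
Hypothesis A : curve_exponents n a d.
Local Notation R := (curve_ring k n a d).
Local Notation S := (in_S n a d).
Local Notation xpoly i f := (evp (cst n a d) (xgen k a d i) f).

Lemma emb_xpoly (i : 'I_n) (f : {poly k}) :
  emb (xpoly i f) = \sum_(j < size f) f`_j *: 'X_[(wexp a d U_(i) *+ j)%MM].
Proof.
rewrite /evp /horner_morph horner_poly rmorph_sum; apply: eq_bigr => j _ /=.
by rewrite rmorphM rmorphXn /= emb_cst emb_xgen mpolyXn mul_mpolyC.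
Qed.

Lemma wexpU_mulI (i : 'I_n) j j' : (wexp a d U_(i) *+ j)%MM = (wexp a d U_(i) *+ j')%MM -> j = j'.
Proof.
move=> /(congr1 (@mdeg 2)); rewrite !mdegMn (mdeg_wexp A) mdeg1 mul1n => /eqP.
by rewrite eqn_pmul2l ?(d_gt0 A) // => /eqP.
Qed.

Lemma xpoly_neq0 (i : 'I_n) f : f != 0 -> xpoly i f != 0.
Proof.
move=> f0; apply/eqP => /(congr1 (@emb k n a d)); rewrite rmorph0 emb_xpoly.
have sf : (0 < size f)%N by rewrite lt0n size_poly_eq0.
have lt : ((size f).-1 < size f)%N by rewrite prednK.
move=> /(congr1 (mcoeff (wexp a d U_(i) *+ (size f).-1)%MM)).
rewrite mcoeff0 raddf_sum (bigD1 (Ordinal lt)) //= mcoeffZ mcoeffX eqxx mulr1.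
rewrite big1 ?addr0 => [|j nj]; first by move/eqP; rewrite -/(lead_coef f) lead_coef_eq0 (negPf f0).
rewrite mcoeffZ mcoeffX; case: eqP => [/wexpU_mulI e|]; rewrite ?mulr0 //.
by case/eqP: nj; apply: val_inj.
Qed.

Hypothesis E_empty : forall p, ~ in_E n a d p.
Variables (i0 iN : 'I_n).
Hypotheses (i0E : i0 = 0%N :> nat) (iNE : iN = n.-1 :> nat).

Let w0 := wexp a d U_(i0).
Let wN := wexp a d U_(iN).
Let pt0 : pt w0 = avec a d 0. Proof. by rewrite /w0 pt_wexpU i0E. Qed.
Let ptN : pt wN = avec a d n.-1. Proof. by rewrite /wN pt_wexpU iNE. Qed.
Let S0 : S (avec a d 0). Proof. by rewrite -i0E; apply: in_S_avec. Qed.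
Let SN : S (avec a d n.-1). Proof. by rewrite -iNE; apply: in_S_avec. Qed.

(** Apply emptiness of E_S at the last q = p - j a_0 still in S: if q + a_(n-1) - a_0 were in S,
    then q + a_(n-1) would be in E_S. *)
Lemma in_S_subMn p D : S p -> ~ S (p - avec a d 0 *+ D) ->
  ~ S (p + avec a d n.-1 - avec a d 0 *+ D).
Proof.
move=> Sp; elim: D => [|D IH]; first by rewrite mulr0n subr0.
have e q : q - avec a d 0 *+ D.+1 = q - avec a d 0 *+ D - avec a d 0.
  by rewrite mulrSr opprD addrA.
rewrite !e; have [SD nS|nSD _] := EM (S (p - avec a d 0 *+ D)); last first.
  by move=> /in_SD/(_ S0); rewrite subrK; apply: IH.
set q := p - avec a d 0 *+ D in SD nS *.
have -> : p + avec a d n.-1 - avec a d 0 *+ D = q + avec a d n.-1 by rewrite addrAC.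
move=> Sq; apply: (E_empty (p := q + avec a d n.-1)); split=> //.
- exact: in_SD.
- by rewrite addrK.
- by rewrite addrAC addrK.
Qed.

Section Division.
Variable f : {poly k}.
Hypothesis f0 : f != 0.
Let D := (size f).-1.
Let sf : size f = D.+1. Proof. by rewrite prednK // lt0n size_poly_eq0. Qed.

(* Normal forms modulo f(x_0): supports in the complement of S + D a_0. *)
Definition reduced (m : 'X_{1..2}) : Prop := S (pt m) /\ ~ S (pt m - avec a d 0 *+ D).

Let emb_f : emb (xpoly i0 f) = \sum_(j < D.+1) f`_j *: 'X_[(w0 *+ j)%MM].
Proof. by rewrite emb_xpoly -/w0 sf. Qed.

(** As x_0 = v^d, a monomial of [q] with largest v-exponent times the leading term of f(x_0) cannot
    cancel; but it lies in S + D a_0, so it is not reduced. *)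
Lemma reduced_mul_eq0 (q : R) : supp_in reduced (emb (xpoly i0 f * q)) -> q = 0.
Proof.
move=> red; apply: (@emb_inj k n a d); rewrite rmorph0; apply/eqP.
rewrite -msupp_eq0; apply/negPn/negP => /(seq_argmax (fun m : 'X_{1..2} => m ord_max)).
move=> [m mq mmax]; have [] := red (w0 *+ D + m)%MM; last first.
  move=> _; rewrite ptD ptMn pt0 addrAC subrr add0r; apply; exact: supp_emb mq.
rewrite mcoeff_msupp rmorphM /= emb_f mulr_suml raddf_sum /= big_ord_recr /= big1 => [|j _].
  by rewrite add0r -scalerAl mcoeffZ mulrC mulrC [_ 'X_[_] _]mulrC mcoeffMX mulf_neq0 -?mcoeff_msupp //
    -?lead_coefE lead_coef_eq0.
rewrite -scalerAl mcoeffZ.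
have -> : (w0 *+ D + m)%MM = (w0 *+ j + (w0 *+ (D - j) + m))%MM.
  by apply: pt_inj; rewrite !ptD !ptMn addrA -mulrnDr subnKC // ltnW.
rewrite [_ 'X_[_] _]mulrC mcoeffMX memN_msupp_eq0 ?mulr0 //.
apply/negP => /mmax; rewrite mnmDE mulmnE.
have := ltn_ord j; have : (0 < w0 ord_max)%N.
  by have /(congr1 snd) := pt0; rewrite (avec0 A) /= => -[->]; apply: d_gt0 A.
rewrite -subn_gt0; nia.
Qed.

(** Long division: the monomials in S + D a_0 form x_0^D x', and x_0^D is rewritten through the
    leading term of f. The leftover low(x_0) x' has smaller v-exponents, whence the induction on
    their bound [B]. *)
Lemma division_x0 (y : R) : exists q r, y = xpoly i0 f * q + r /\ supp_in reduced (emb r).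
Proof.
have [B hB] : exists B, supp_in (fun m : 'X_{1..2} => (m ord_max < B)%N) (emb y).
  exists (msize (emb y)) => m /msize_mdeg_lt; apply: leq_ltn_trans.
  by rewrite mdegE (bigD1 ord_max) //= leq_addr.
elim: B y hB => [|B IH] y hB.
  exists 0, 0; split; last by rewrite rmorph0; apply: supp_in0.
  rewrite mulr0 addr0; apply: (@emb_inj k n a d); rewrite rmorph0.
  by apply: (supp_in_eq0 _ hB hB) => m.
pose Q m := asbool (S (pt m - avec a d 0 *+ D)).
have [|r0 r0E] := @emb_onto k n a d (emb y - mrestrict Q (emb y)).
  by apply: supp_in_mrestrictC => m /supp_emb.
have [m mQ|x xE xB] := supp_in_divX (m0 := (w0 *+ D)%MM) (p := mrestrict Q (emb y))
    (D := fun m => S (pt m) /\ (m ord_max + d * D < B.+1)%N).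
  move: mQ; rewrite mcoeff_msupp mcoeff_mrestrict /Q; case: asboolP => [Sm|]; last by rewrite eqxx.
  rewrite -mcoeff_msupp => my; have [t [h1 h2 _]] := in_S_deg A Sm.
  have [m' m'E] := pt_surj h1 h2; have mE : m = (w0 *+ D + m')%MM.
    by apply: pt_inj; rewrite ptD ptMn pt0 m'E addrC subrK.
  exists m' => //; rewrite m'E; split=> //; have := hB m my.
  have /(congr1 snd) := pt0; rewrite (avec0 A) /= => -[w0E].
  by rewrite mE mnmDE mulmnE w0E addnC.
have [x' x'E] := emb_onto (fun m h => (xB m h).1).
pose low := \poly_(j < D) f`_j; pose l := lead_coef f.
have fE : f = low + l *: 'X^D.
  by rewrite -[LHS]coefK sf poly_def big_ord_recr /= -poly_def.
have yE : y = xgen k a d i0 ^+ D * x' + r0.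
  apply: (@emb_inj k n a d); rewrite rmorphD rmorphM rmorphXn /= emb_xgen mpolyXn.
  by rewrite x'E -xE r0E addrC subrK.
have [|q' [r' [yE' hr']]] := IH (xpoly i0 low * x').
  rewrite rmorphM /= emb_xpoly x'E.
  apply: (supp_inM (D1 := fun m : 'X_{1..2} => (m ord_max + d <= d * D)%N)) xB.
    by move=> m1 m2 h1 [_ h2]; rewrite mnmDE; have := d_gt0 A; lia.
  apply: supp_in_sum => j _; apply: supp_inZ; apply: supp_inX.
  have /(congr1 snd) := pt0; rewrite (avec0 A) /= => -[w0E].
  rewrite mulmnE w0E -mulnSr leq_mul2l; apply/orP; right.
  by apply: leq_trans (ltn_ord j) (size_poly _ _).
have ev_f : xpoly i0 f = xpoly i0 low + cst n a d l * xgen k a d i0 ^+ D.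
  by rewrite {1}fE rmorphD -mul_polyC rmorphM rmorphXn /= evpC evpX.
have l1 : cst n a d l * cst n a d l^-1 = 1.
  by rewrite -rmorphM divff ?rmorph1 // lead_coef_eq0.
exists (cst n a d l^-1 * (x' - q')), (r0 - cst n a d l^-1 * r'); split.
  have : xpoly i0 low * x' = xpoly i0 f * q' + r' by [].
  rewrite yE ev_f; move: (xpoly i0 low) (cst n a d l) (cst n a d l^-1) l1 (_ ^+ D) => L c c' cc' s h.
  have -> : r' = L * x' - (L + c * s) * q' by rewrite h; ring.
  ring: cc'.
rewrite rmorphB /= r0E rmorphM /= emb_cst mul_mpolyC; apply: supp_inB; last exact: supp_inZ.
by apply: supp_in_mrestrictC => m /supp_emb Sm; rewrite /Q; case: asboolP.
Qed.

(** By [in_S_subMn], x_(n-1) preserves reduced supports. For the remainder r of [y], the product g r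
    is then reduced and a multiple of f(x_0), hence 0, and R is a domain. *)
Lemma xpoly_regular (g : {poly k}) (y z : R) : g != 0 ->
  xpoly iN g * y = xpoly i0 f * z -> exists q, y = xpoly i0 f * q.
Proof.
move=> g0 gy; have [q [r [yE rred]]] := division_x0 y.
exists q; rewrite yE; suff -> : r = 0 by rewrite addr0.
have grE : xpoly iN g * r = xpoly i0 f * (z - xpoly iN g * q).
  by rewrite mulrBr -gy yE; ring.
have gr0 : xpoly iN g * r = 0.
  rewrite grE (@reduced_mul_eq0 (z - xpoly iN g * q)) ?mulr0 // -grE.
  rewrite rmorphM /= emb_xpoly; apply: (supp_inM (D1 := fun m => exists j, m = (wN *+ j)%MM)) rred.
    move=> _ m [j ->]; elim: j => [|j IH] mred; first by rewrite mulm0n add0m.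
    have [Sm nSm] := IH mred.
    rewrite mulmS -addmA /reduced ptD ptN addrC; split; first exact: in_SD.
    exact: in_S_subMn.
  by apply: supp_in_sum => j _; apply: supp_inZ; apply: supp_inX; exists j.
by have [/eqP|//] := curve_mulf0 gr0; rewrite (negPf (xpoly_neq0 _ g0)).
Qed.

End Division.

End RegularPair.

(** * A prime ideal strictly inside P *)

Section PrimeAvoiding.
Variables (R : comNzRingType) (P : R -> Prop) (f g : R).
Hypothesis P_prime : is_prime_ideal P.
Hypothesis Pf : P f.
Hypothesis fg_regular : forall y z, g * y = f * z -> exists q, y = f * q.

(** Contains the complement of P (N = 0) and g (t = 1), so an ideal avoiding it lies in P and misses
    g. *)
Let T u := exists t N, ~ P t /\ u = t * g ^+ N.

(* If the multiplicative set T met f R, then cancelling powers of g modulo f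
   would put an element outside P in f R. *)
Let T_f z : ~ T (f * z).
Proof.
move=> [t [N [Pt e]]]; apply: Pt; have [[_ _ PM] _ _] := P_prime.
elim: N z e => [|N IH] z e.
  by move: e; rewrite expr0 mulr1 => <-; rewrite mulrC; apply: PM.
have [|q qE] := @fg_regular (t * g ^+ N) z; first by rewrite e exprS mulrCA.
exact: IH (esym qE).
Qed.

Let T_mul u v : T u -> T v -> T (u * v).
Proof.
have [_ _ PP] := P_prime.
move=> [t [N [Pt ->]]] [t' [N' [Pt' ->]]]; exists (t * t'), (N + N')%N.
by split; [move=> /PP[]|rewrite exprD; ring].
Qed.

Let good (J : R -> Prop) := [/\ is_ideal J, J f & forall u, J u -> ~ T u].

Let max_good : exists2 J, good J & forall J', good J' -> (forall x, J x -> J' x) ->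
  forall x, J' x -> J x.
Proof.
have good_f : good (fun u => exists z, u = f * z).
  split=> [||_ [z ->]]; [|by exists 1; rewrite mulr1|exact: T_f].
  split=> [|_ _ [z ->] [z' ->]|r _ [z ->]]; first by exists 0; rewrite mulr0.
    by exists (z + z'); rewrite mulrDr.
  by exists (r * z); rewrite mulrCA.
pose Q (J : R -> Prop) := (forall x, ~ J x) \/ good J.
have [F FQ Ftot|J [QJ Jmax]] := @classical_sets.Zorn_bigcup R Q.
  have [[J0 [FJ0 J0x]]|noJ] := EM (exists J, F J /\ exists x, J x); last first.
    by left=> x [J FJ Jx]; apply: noJ; exists J; split=> //; exists x.
  have gd J x : F J -> J x -> good J by move=> FJ Jx; case: (FQ J FJ) => // /(_ x).
  have [x0 J0x0] := J0x; have [[J00 _ _] J0f _] := gd J0 x0 FJ0 J0x0.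
  right; split=> [||u [J FJ Ju]]; last 1 first.
  - by have [_ _] := gd J u FJ Ju; apply.
  - split=> [|x y [J FJ Jx] [J' FJ' J'y]|r x [J FJ Jx]]; first by exists J0.
      have [sJ|sJ] := Ftot J J' FJ FJ'.
        exists J' => //; have [[_ JD _] _ _] := gd J' y FJ' J'y.
        by apply: JD => //; apply: sJ.
      exists J => //; have [[_ JD _] _ _] := gd J x FJ Jx.
      by apply: JD => //; apply: sJ.
    by exists J => //; have [[_ _ JM] _ _] := gd J x FJ Jx; apply: JM.
  - by exists J0.
have gJ : good J.
  case: QJ => // J0; case: (Jmax (fun u => exists z, u = f * z)); last by right.
  split; first by move=> x /J0.
  by move=> h; apply: (J0 f); apply: h; exists 1; rewrite mulr1.
exists J => // J' gJ' JJ' x J'x; apply: contrapT => nJx.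
apply: (Jmax J'); last by right.
by split=> // h; apply: nJx; apply: h.
Qed.

(** For x and y outside a maximal J, both J + xR and J + yR meet [T]; the product of the two
    elements found is in [T], and would be in J if x y were. *)
Lemma prime_between : exists2 J, is_prime_ideal J &
  [/\ J f, ~ J g & forall x, J x -> P x].
Proof.
have [J [[J0 JD JM] Jf JT] Jmax] := max_good.
have P1 : ~ P 1 by case: P_prime.
have T1 u : ~ P u -> T u by move=> Pu; exists u, 0%N; rewrite mulr1.
exists J; last split=> //.
- have add_meets x : ~ J x -> exists u r, J u /\ T (u + r * x).
    move=> Jx; apply: contrapT => noT; apply: Jx.
    pose J' z := exists u r, J u /\ z = u + r * x.
    apply: (Jmax J'); last by exists 0, 1; rewrite add0r mul1r.
      split=> [||z [u [r [Ju ->]]] Tz]; [|by exists f, 0; rewrite mul0r addr0|by apply: noT; exists u, r].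
      split=> [|_ _ [u [r [Ju ->]]] [u' [r' [Ju' ->]]]|b _ [u [r [Ju ->]]]].
      + by exists 0, 0; rewrite mul0r addr0.
      + by exists (u + u'), (r + r'); split; [apply: JD|ring].
      + by exists (b * u), (b * r); split; [apply: JM|ring].
    by move=> z Jz; exists z, 0; rewrite mul0r addr0.
  split=> [//|J1|x y Jxy]; first exact: JT J1 (T1 _ P1).
  apply: contrapT => /not_orP[/add_meets[u [r [Ju Tu]]] /add_meets[v [s [Jv Tv]]]].
  apply: (JT _ _ (T_mul Tu Tv)).
  have -> : (u + r * x) * (v + s * y) = (v + s * y) * u + (r * x) * v + (r * s) * (x * y) by ring.
  by apply: (JD _ _ (JD _ _ _ _)); apply: JM.
- by move=> Jg; apply: JT Jg _; exists 1, 1%N; rewrite mul1r expr1.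
- by move=> x Jx; apply: contrapT => /T1; apply: JT.
Qed.

End PrimeAvoiding.

(** * Height and depth equal to 2 when E_S is empty *)

Section CohenMacaulayCurve.
Variables (k : fieldType) (n : nat) (a : nat -> nat) (d : nat).
Hypothesis A : curve_exponents n a d.
Hypothesis k_inf : infinite_type k.
Hypothesis E_empty : forall p, ~ in_E n a d p.
Local Notation R := (curve_ring k n a d).

Lemma curve_cohen_macaulay : cohen_macaulay R.
Proof.
move=> P P_max; have n1 : (1 < n)%N by case: A.
have P_prime := maximal_ideal_prime P_max; have [idP P1 _] := P_prime.
pose i0 : 'I_n := Ordinal (ltnW n1); have ltN : (n.-1 < n)%N by lia.
pose iN : 'I_n := Ordinal ltN.
have [f f0 Pf] := maximal_ideal_poly A k_inf P_max (i := i0) (j := iN) (or_introl (conj erefl erefl)).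
have [g g0 Pg] := maximal_ideal_poly A k_inf P_max (i := iN) (j := i0) (or_intror (conj erefl erefl)).
set f' := evp _ _ f in Pf; set g' := evp _ _ g in Pg.
have reg y z : g' * y = f' * z -> exists q, y = f' * q.
  exact: (xpoly_regular A E_empty (i0 := i0) (iN := iN) erefl erefl f0 g0).
have f'0 : f' != 0 by apply: xpoly_neq0 A _ _ f0.
exists 2; split; split.
- have [J Jprime [Jf Jg JP]] := prime_between P_prime Pf reg.
  exists (fun i => if i is i'.+1 then (if i' is 0 then J else P) else eq^~ 0); split.
  + case=> [|[|i]] _ //; split.
    * split=> [//|x y -> ->|r x ->]; by rewrite ?addr0 ?mulr0.
    * by move/eqP; rewrite oner_eq0.
    * exact: curve_mulf0.
  + case=> [|[|//]] _; split=> //.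
    * by move=> x ->; case: Jprime => -[].
    * by exists f'; split=> //; apply/eqP.
    * by exists g'.
  + by [].
- by move=> l c; apply: prime_chain_le2.
- exists [:: f'; g'] => //; split; last by move=> x; rewrite !inE => /orP[]/eqP->.
  split=> [[|[|//]] _ x /=|].
  + move=> /generated_ideal_nil/curve_mulf0[/eqP|->]; first by rewrite (negPf f'0).
    by case: (generated_ideal_ideal (Nil R)).
  + move=> [c]; rewrite big_ord1 /= [c _ * _]mulrC => /reg[q ->].
    by exists (fun=> q); rewrite big_ord1 mulrC.
  + move=> h; apply: P1; apply: generated_ideal_sub idP _ _ h => x.
    by rewrite !inE => /orP[]/eqP->.
- by move=> s [+ _]; apply: regular_sequence_le2.
Qed.

End CohenMacaulayCurve.

Theorem theorem4p6 (k : fieldType) (n d : nat) (a : nat -> nat)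
  (k_inf : infinite_type k)
  (n_ge4 : (4 <= n)%N)
  (a_first : a 0%N = 0%N)
  (a_incr : forall i j, (i < j < n)%N -> (a i < a j)%N)
  (a_last : a n.-1 = d)
  (a_gcd : (\big[gcdn/0]_(1 <= i < n) a i)%N = 1%N)
  (not_CM : ~ cohen_macaulay (curve_ring k n a d))
  (F : free_complex (curve_ring k n a d))
  (F_min : minimal_graded_free_resolution (curve_gr (d := d)) F)
  (p : nat) (p_pd : is_projdim F p)
  (reg : int) (reg_reg : is_regularity F reg)
  (r : int) (r_hreg : is_hilbert_regularity (@curve_gr k n a d) r)
  (mE mAP : option int) (mE_max : is_mE n a d mE) (mAP_max : is_mAP n a d mAP) :
  [/\ betti F p (p%:Z + reg) != 0%N <-> Some reg = mE,
      Some reg = mE <-> ele mAP mE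
    & Some reg = mE <-> reg = r].
Proof.
have A : curve_exponents n a d by split=> //; lia.
have [F_graded F_res F_minimal] := F_min.
have n0 : (0 < n)%N by lia.
have nN : (n.-1 < n)%N by lia.
pose y0 : 'I_n := Ordinal n0; pose yN : 'I_n := Ordinal nN.
have [e [mEe E_ex E_le]] : exists e : nat, [/\ mE = Some e%:Z,
    exists2 q, in_E n a d q & in_L d e.+1 q
    & forall s q, in_E n a d q -> in_L d s q -> (s <= e.+1)%N].
  (* Points of E_S have positive degree, so the shift s + 1 in m(E_S) loses none of them. *)
  have E_pos s q : in_E n a d q -> in_L d s q -> (0 < s)%N.
    move=> [_ S0 _ _] Lq; exact: (in_LB A Lq (in_L_avec A n0) S0).1.
  case: mE mE_max => [_ [[e -> [q [Eq Lq]]] emax]|noE].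
    exists e; split=> //; first by exists q.
    move=> [|s] q' Eq' Lq' //; rewrite ltnS -lez_nat.
    by apply: emax; exists s => //; exists q'.
  (* m(E_S) = -oo would mean that E_S is empty and R Cohen-Macaulay. *)
  case: not_CM; apply: (curve_cohen_macaulay A k_inf) => q Eq.
  have [Sq _ _ _] := Eq; have [[|s] Lq] := in_S_deg A Sq.
    by have := E_pos _ _ Eq Lq.
  by apply: (noE s%:Z); exists s => //; exists q.
have [m [mAPm AP_ex AP_le]] : exists m : nat, [/\ mAP = Some m%:Z,
    exists2 q, in_AP n a d q & in_L d m q
    & forall s q, in_AP n a d q -> in_L d s q -> (s <= m)%N].
  case: mAP mAP_max => [_ [[m -> [q [Aq Lq]]] mmax]|noAP].
    exists m; split=> //; first by exists q.
    by move=> s q' Aq' Lq'; rewrite -lez_nat; apply: mmax; exists s => //; exists q'.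
  (* The origin lies in AP_S, so m(AP_S) is finite. *)
  case: (noAP 0); exists 0%N => //; exists 0; split; last exact: in_L0.
  have nS q : in_L d 1 q -> ~ in_S n a d (0 - q).
    by move=> Lq /(in_LB A (in_L0 d) Lq)[].
  by split; [exact: in_S0|exact: nS (in_L_avec A n0)|exact: nS (in_L_avec A nN)].
have pE := projdim_curve A F_graded F_res erefl erefl E_le F_minimal E_ex (y0 := y0) (yN := yN) p_pd.
have regE := regularity_curve A F_graded F_res erefl erefl E_le AP_le F_minimal E_ex (y0 := y0) (yN := yN) AP_ex reg_reg.
have last0 := betti_last_neq0 A F_graded F_res erefl erefl E_le E_ex (y0 := y0) (yN := yN).
have lastle := betti_last_le A F_graded F_res erefl erefl E_le F_minimal (y0 := y0) (yN := yN).
have [hr1 hr2] := hilbert_regularity_curve A E_le AP_le E_ex r_hreg.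
rewrite mEe mAPm pE /=.
(* As reg = max(e, m), each of the conditions amounts to m <= e. *)
have mEiff : Some reg = Some e%:Z <-> (m <= e)%N.
  by rewrite regE; split=> [[]|le]; [lia|congr Some; lia].
split.
- split=> [/lastle le|[->] //].
  by apply/mEiff; move: le; rewrite regE; lia.
- by rewrite mEiff lez_nat.
- rewrite mEiff; split=> [le|regr]; first by rewrite regE (hr1 le); lia.
  by rewrite leqNgt; apply/negP => lt; have := hr2 lt; rewrite -regr regE; lia.
Qed.
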